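(* Let $\sigma=(\sigma_j)_{j\in\mathbb N}$ be a non-increasing sequence of non-negative real numbers with $\sigma_n\asymp a^n$ for some $a\in(0,1)$. Then $$a^n\ \preccurlyeq\ \mathbb E[\mathcal R_n(\sigma)]\ \preccurlyeq\ n^2a^n.$$
   Context: For sequences $(a_n)_{n\in\mathbb N}$, $(b_n)_{n\in\mathbb N}$ write $a_n\preccurlyeq b_n$ if there is a constant $C>0$ with $a_n\le C\,b_n$ for all $n\in\mathbb N$, and $a_n\asymp b_n$ if both $a_n\preccurlyeq b_n$ and $b_n\preccurlyeq a_n$. Convention: $a/0=\infty$ for $a>0$ and $0/0=0$. Put $H_\sigma=\{x\in\ell_2:\sum_{j\in\mathbb N}(x_j/\sigma_j)^2<\infty\}$ and $\mathcal E_\sigma=\{x\in\ell_2:\sum_{j\in\mathbb N}(x_j/\sigma_j)^2\le 1\}$. $G_n=(g_{ij})_{1\le i\le n,\,j\in\mathbb N}$ is a random matrix with independent standard Gaussian entries, and $G_nx=(\sum_{j}g_{ij}x_j)_{i=1}^n$, where a component is assigned the value NaN if its series does not converge (for $\sigma\in\ell_2$, almost surely all these series converge for all $x\in H_\sigma$). The radius of random information is $$\mathcal R_n(\sigma)=\inf_{\phi}\ \sup_{x\in\mathcal E_\sigma}\|\phi(G_nx)-x\|_2,$$ the infimum being over all mappings $\phi$ from the image of $G_n$ (on $H_\sigma$) to $\ell_2$. *)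

(* Defs.v *)
(* MathComp-Analysis development, over an arbitrary [R : realType]. *)
From HB Require Import structures.
From mathcomp Require Export all_boot all_order all_algebra.
From mathcomp Require Export all_classical all_reals all_analysis.

Set Implicit Arguments.
Unset Strict Implicit.
Unset Printing Implicit Defensive.

Import Order.TTheory GRing.Theory Num.Theory.
Import numFieldNormedType.Exports.

Local Open Scope classical_set_scope.
Local Open Scope ring_scope.

(* Convention: mathematically, sequences are indexed by N = {1, 2, ...}.
   Here they are functions on [nat], the value at [n] being the term of index
   n + 1. *)

(* u_n ≼ v_n *)
Definition preccurly (R : realType) (u v : nat -> \bar R) : Prop :=
  exists2 C : R, 0 < C & forall n, (u n <= C%:E * v n)%E.

(* u_n ≍ v_n *)
Definition asymp (R : realType) (u v : nat -> \bar R) : Prop :=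
  preccurly u v /\ preccurly v u.

Definition l2norm (R : realType) (x : nat -> R) : \bar R :=
  ('N[counting]_(2%:E)[EFin \o x])%E.

Definition l2 (R : realType) : set (nat -> R) :=
  [set x | (l2norm x < +oo)%E].

(* The quotient is taken in [\bar R], where 0^-1 = +oo and 0 * +oo = 0; hence
   (x_j / 0)^2 is +oo if x_j != 0 and 0 if x_j = 0. *)
Definition ellipsoid_sum (R : realType) (sigma x : nat -> R) : \bar R :=
  (\sum_(j <oo) ((x j)%:E / (sigma j)%:E) ^+ 2)%E.

(* H_σ *)
Definition Hspace (R : realType) (sigma : nat -> R) : set (nat -> R) :=
  [set x | l2 x /\ (ellipsoid_sum sigma x < +oo)%E].

(* E_σ *)
Definition ellipsoid (R : realType) (sigma : nat -> R) : set (nat -> R) :=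
  [set x | l2 x /\ (ellipsoid_sum sigma x <= 1)%E].

(* The vector G x, for a matrix G with n rows and infinitely many columns;
   [None] stands for NaN. *)
Definition info (R : realType) (n : nat) (G : 'I_n -> nat -> R)
    (x : nat -> R) : 'I_n -> option R :=
  fun i => let s := series (fun j => G i j * x j) in
    if `[< cvgn s >] then Some (limn s) else None.

(* The radius of the information x |-> G x. The maps phi are total functions,
   only constrained, and only evaluated, on the image of [Hspace sigma]. *)
Definition radius (R : realType) (sigma : nat -> R) (n : nat)
    (G : 'I_n -> nat -> R) : \bar R :=
  ereal_inf [set ereal_sup
      [set l2norm (phi (info G x) \- x) | x in ellipsoid sigma]
    | phi in set_fun (info G @` Hspace sigma) (@l2 R)].

(* The product rule over every finite subfamily, each listed by a
   duplicate-free sequence of indices. *)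
Definition mutually_independent d (T : measurableType d) (R : realType)
    (P : probability T R) (I : eqType) (X : I -> {RV P >-> R}) : Prop :=
  forall (s : seq I) (A : I -> set R), uniq s ->
    (forall k, measurable (A k)) ->
    P [set w | forall k, k \in s -> A k (X k w)]
      = (\prod_(k <- s) P (X k @^-1` A k))%E.

Definition gaussian_matrix d (T : measurableType d) (R : realType)
    (P : probability T R) (n : nat) (G : 'I_n -> nat -> {RV P >-> R}) : Prop :=
  (forall i j, distribution P (G i j) = normal_prob 0 1 :> (set R -> \bar R))
  /\ mutually_independent (fun ij : 'I_n * nat => G ij.1 ij.2).

(* E[R_n(σ)]. For square-summable [sigma], [radius] agrees with a bounded
   measurable function off a null event (where some series defining G x
   diverges), so the integral does not depend on how [\int] treats
   non-measurable functions. *)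
Definition expected_radius d (T : measurableType d) (R : realType)
    (P : probability T R) (sigma : nat -> R) (n : nat)
    (G : 'I_n -> nat -> {RV P >-> R}) : \bar R :=
  (\int[P]_w radius sigma (fun i j => G i j w))%E.

(* Main.v *)
(* The lower bound is deterministic: the kernel of G meets the span of the first
   m + 1 unit vectors, m being the number of rows, so x and -x on the boundary of
   the ellipsoid give the same information and one of them is missed by at least
   sigma_{m+1}.

   For the upper bound, let u_j be the vector of cofactors along the j-th column
   of the square matrix formed by the first m columns c_1, ..., c_m. It is
   orthogonal to the other c_i, so for z in the kernel of G and v_j = u_j / |u_j|,
     <v_j, c_j> z_j = - sum_{l > m} <v_j, c_l> z_l.
   The right-hand side is of order a^m, because v_j is independent of c_l, l > m.
   As v_j is also independent of c_j, the scalar <v_j, c_j> is standard normal;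
   1/|<v_j, c_j>| is not integrable, but since |z_j| is bounded it may be
   truncated at a^-m, which leaves an expectation of order m. Summing over j <= m
   yields m^2 a^m.

   Expectations of Gaussian combinations are only needed for functions
   exp(- l y^2 / 2), for which adding an independent normal variable is one
   completion of the square. *)
From HB Require Import structures.
Require Import Defs.
From mathcomp Require Import measurable_realfun.
From mathcomp Require Import ring lra.

Set Implicit Arguments.
Unset Strict Implicit.
Unset Printing Implicit Defensive.

Import Order.TTheory GRing.Theory Num.Theory.
Import numFieldNormedType.Exports.
Local Open Scope classical_set_scope.
Local Open Scope ring_scope.

(** * Gaussian smoothing *)

Section normal_integral.
Context (R : realType) (m s : R).
Local Notation mu := lebesgue_measure.
Import HBNNSimple.

Let normal_indic (E : set R) : measurable E ->
  (\int[normal_prob m s]_x (\1_E x)%:E =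
   \int[mu]_x ((\1_E x)%:E * (normal_pdf m s x)%:E))%E.
Proof.
move=> mE; rewrite integral_indic// setIT /= /normal_prob integral_mkcond.
apply: eq_integral => x _; rewrite patchE indicE; case: ifPn => /= _.
  by rewrite mul1e.
by rewrite mul0e.
Qed.

Let measurable_pdfE : measurable_fun setT (EFin \o normal_pdf m s).
Proof. by apply/measurable_EFinP; exact: measurable_normal_pdf. Qed.

Let measurable_level (f : {nnsfun measurableTypeR R >-> R}) (r : R) :
  measurable_fun setT (EFin \o (\1_(f @^-1` [set r]) : measurableTypeR R -> R)).
Proof.
apply/measurable_EFinP; apply: measurable_indic.
exact: measurable_funPTI.
Qed.

Let measurable_levelM (f : {nnsfun measurableTypeR R >-> R}) (r : R) :
  measurable_fun setT (fun x => (r * \1_(f @^-1` [set r]) x)%:E).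
Proof.
by apply/measurable_EFinP; apply: measurable_funM.
Qed.

Let normal_nnsfun (f : {nnsfun measurableTypeR R >-> R}) :
  (\int[normal_prob m s]_x (f x)%:E =
   \int[mu]_x ((f x)%:E * (normal_pdf m s x)%:E))%E.
Proof.
under [LHS]eq_integral do rewrite fimfunE -fsumEFin//.
rewrite [LHS]ge0_integral_fsum//; last 2 first.
  - by move=> r; exact: measurable_levelM.
  - by move=> n x _; rewrite EFinM nnfun_muleindic_ge0.
under [RHS]eq_integral.
  move=> x xD; rewrite fimfunE -fsumEFin// ge0_mule_fsuml; last first.
    by move=> r; rewrite EFinM nnfun_muleindic_ge0.
  over.
rewrite [RHS]ge0_integral_fsum//; last 2 first.
  - move=> r; apply: emeasurable_funM; last exact: measurable_pdfE.
    exact: measurable_levelM.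
  - move=> n x _; apply: mule_ge0; last by rewrite lee_fin normal_pdf_ge0.
    by rewrite EFinM nnfun_muleindic_ge0.
apply: eq_fsbigr => r _.
have mfr : measurable (f @^-1` [set r]) by exact: measurable_funPTI.
rewrite integralZl_indic_nnsfun// normal_indic//.
have [r0|r0] := ltP r 0.
  rewrite (_ : f @^-1` [set r] = set0); last first.
    by apply/seteqP; split => // x /= fx; move: r0; rewrite -fx ltNge fun_ge0.
  by rewrite !integral0_eq ?mule0// => x _; rewrite indicE in_set0 ?mulr0 mul0e.
rewrite -ge0_integralZl//.
- by apply: eq_integral => x _; rewrite EFinM muleA.
- by apply: emeasurable_funM; [exact: measurable_level|].
- by move=> x _; rewrite mule_ge0 ?lee_fin ?normal_pdf_ge0.
Qed.

(** The density formula passes from indicators to simple functions by linearity, and then to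
    nonnegative functions by monotone convergence on both sides. *)
Lemma ge0_integral_normal_prob (f : measurableTypeR R -> \bar R) :
  measurable_fun setT f -> (forall x, 0 <= f x)%E ->
  (\int[normal_prob m s]_x f x = \int[mu]_x (f x * (normal_pdf m s x)%:E))%E.
Proof.
move=> mf f0.
pose f_ := nnsfun_approx measurableT mf.
transitivity (lim (\int[normal_prob m s]_x (f_ n x)%:E @[n --> \oo])%E).
  rewrite -monotone_convergence//=.
  - apply: eq_integral => ? /[!inE] xD; apply/esym/cvg_lim => //=.
    exact: cvg_nnsfun_approx.
  - by move=> n; exact/measurable_EFinP/measurable_funTS.
  - by move=> n ? _; rewrite lee_fin.
  - by move=> ? _ ? ? mn; rewrite lee_fin; exact/lefP/nd_nnsfun_approx.
under eq_fun do rewrite normal_nnsfun.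
rewrite -monotone_convergence//=.
- apply: eq_integral => x /[!inE] xD; apply/cvg_lim => //=.
  by apply: cvgeZr => //; exact: cvg_nnsfun_approx.
- move=> n; apply: emeasurable_funM => //.
  exact/measurable_EFinP/measurable_funTS.
- by move=> n x _; rewrite mule_ge0 ?lee_fin ?normal_pdf_ge0.
- move=> x _ p q pq; rewrite lee_wpmul2r ?lee_fin ?normal_pdf_ge0//.
  exact/lefP/nd_nnsfun_approx.
Qed.

End normal_integral.

(* The expectation of exp(- l (y + v^(1/2) g)^2 / 2) for a standard normal g,
   meaningful as long as 1 + l v > 0. *)
Definition heat (R : realType) (l v y : R) : R :=
  expR (- l * y ^+ 2 / (2 * (1 + l * v))) / Num.sqrt (1 + l * v).

Section heat.
Context (R : realType) (l : R).

Lemma heat_ge0 (v y : R) : 0 <= heat l v y.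
Proof. by rewrite mulr_ge0 ?expR_ge0 ?invr_ge0 ?sqrtr_ge0. Qed.

(** Semigroup law of Gaussian convolution: variances add, so the term [c * x] advances the time [v]
    by c^2. *)
Lemma heat_comp (c v y : R) : 0 < 1 + l * v -> 0 < 1 + l * (v + c ^+ 2) ->
  (\int[normal_prob 0 1]_x (heat l v (c * x + y))%:E =
   (heat l (v + c ^+ 2) y)%:E)%E.
Proof.
set p := 1 + l * v; set q := 1 + l * (v + c ^+ 2) => p0 q0.
have sp0 : 0 < Num.sqrt p by rewrite sqrtr_gt0.
have sq0 : 0 < Num.sqrt q by rewrite sqrtr_gt0.
have mh : measurable_fun setT (fun x : R => (heat l v (c * x + y))%:E).
  apply/measurable_EFinP; rewrite /heat; apply: measurable_funM => //.
  apply: measurableT_comp => //; apply: measurable_funM => //.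
  apply: measurable_funM => //; apply: measurable_funX.
  by apply: measurable_funD => //; exact: measurable_funM.
rewrite ge0_integral_normal_prob//; last by move=> x; rewrite lee_fin heat_ge0.
(* Completing the square in x: the kernel times the standard density is a normal density of mean [m]
   and variance p / q, up to a factor depending on y alone. *)
pose m := - l * c * y / q; pose s := Num.sqrt p / Num.sqrt q.
have s0 : s != 0 by rewrite gt_eqF// divr_gt0.
have s2 : s ^+ 2 = p / q by rewrite expr_div_n !sqr_sqrtr// ltW.
have key x : heat l v (c * x + y) * normal_pdf 0 1 x =
    heat l (v + c ^+ 2) y * normal_pdf m s x.
  rewrite !normal_pdfE ?oner_eq0// /heat -/p -/q /normal_fun.
  have peakE : (Num.sqrt p)^-1 * normal_peak 1 = (Num.sqrt q)^-1 * normal_peak s.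
    rewrite /normal_peak s2 expr1n mul1r -!mulrnAr -!invfM; congr (_^-1).
    have -> : q = p / (p / q) by rewrite invfM invrK mulrA divff ?mul1r// gt_eqF.
    by rewrite -!sqrtrM ?divr_ge0 ?ltW//; congr Num.sqrt; field;
      rewrite !gt_eqF.
  set e1 := _ / (2 * p); set e2 := _ / (1 ^+ 2 *+ 2).
  set e3 := _ / (2 * q); set e4 := _ / (s ^+ 2 *+ 2).
  have e12 : e1 + e2 = e3 + e4.
    rewrite /e1 /e2 /e3 /e4 s2 /m; move: p0 q0; rewrite /p /q => p0 q0.
    by field; rewrite !gt_eqF.
  transitivity ((Num.sqrt p)^-1 * normal_peak 1 * expR (e1 + e2)).
    by rewrite expRD; ring.
  by rewrite peakE e12 expRD; ring.
under eq_integral do rewrite -EFinM key EFinM.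
rewrite ge0_integralZl ?lee_fin ?heat_ge0//.
- by rewrite integral_normal_pdf mule1.
- by apply/measurable_EFinP; exact: measurable_normal_pdf.
- by move=> x _; rewrite lee_fin normal_pdf_ge0.
Qed.

End heat.

(** * Integrating out independent variables *)

(* The list [s] is fixed, so this generating class is closed under
   intersection. *)
Definition cylinders d (T : measurableType d) (R : realType)
    (P : probability T R) (I : eqType) (X : I -> {RV P >-> R}) (s : seq I) :
    set (set T) :=
  [set B | exists2 A : I -> set R, (forall k, measurable (A k)) &
    B = [set w | forall k, k \in s -> A k (X k w)]].

Notation generated X s := (g_sigma_algebraType (cylinders X s)).

Section independence.
Context d (T : measurableType d) (R : realType) (P : probability T R).
Context (I : eqType) (X : I -> {RV P >-> R}).
Hypothesis indepX : mutually_independent X.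

Lemma cylinders_measurable (s : seq I) : cylinders X s `<=` measurable.
Proof.
move=> _ [A mA ->].
rewrite (_ : [set w | _] = \bigcap_(k in [set` s]) (X k @^-1` A k)); last first.
  by apply/seteqP; split=> w /= h k; apply: h.
by apply: fin_bigcap_measurable => // k _; exact: measurable_funPTI.
Qed.

Lemma generated_measurable (s : seq I) (B : set T) :
  <<s cylinders X s >> B -> measurable B.
Proof.
exact: (smallest_sub (@sigma_algebra_measurable _ T) (@cylinders_measurable s)).
Qed.

Lemma measurable_fun_generated_id (s : seq I) :
  measurable_fun setT (id : T -> generated X s).
Proof.
by move=> _ B mB; rewrite setTI preimage_id; exact: generated_measurable mB.
Qed.

Lemma generated_sub (s t : seq I) : {subset s <= t} ->
  <<s cylinders X s >> `<=` <<s cylinders X t >>.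
Proof.
move=> st; apply: sub_smallest2r; first exact: smallest_sigma_algebra.
move=> _ [A mA ->].
exists (fun k => if k \in s then A k else setT).
  by move=> k; case: ifP => // _; exact: measurableT.
apply/seteqP; split=> w /= h k; first by move=> _; case: ifP => // /h.
by move=> ks; have := h _ (st _ ks); rewrite ks.
Qed.

Lemma measurable_fun_generatedW d' (U : measurableType d') (s t : seq I)
    (f : T -> U) : {subset s <= t} ->
  measurable_fun setT (f : generated X s -> U) ->
  measurable_fun setT (f : generated X t -> U).
Proof. by move=> st mf _ B mB; apply: (generated_sub st); exact: mf. Qed.

Lemma measurable_fun_generatedT d' (U : measurableType d') (s : seq I)
    (f : T -> U) :
  measurable_fun setT (f : generated X s -> U) -> measurable_fun setT f.
Proof. by move=> mf _ B mB; apply: (@generated_measurable s); exact: mf. Qed.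

Lemma measurable_fun_generated (s : seq I) k : k \in s ->
  measurable_fun setT (X k : generated X s -> R).
Proof.
move=> ks _ B mB; apply: sub_gen_smallest.
exists (fun j => if j == k then B else setT).
  by move=> j; case: ifP => // _; exact: measurableT.
apply/seteqP; split=> w /=.
  by move=> [_ Bw] j js; case: eqP => // ->.
by move=> /(_ _ ks); rewrite eqxx.
Qed.

(** Both sides are finite measures in [A]: a restriction of [P] and a multiple of [P]. They agree on
    cylinders by the product rule, and cylinders are closed under intersection, so they agree on the
    generated sigma-algebra. *)
Lemma generated_independent (s : seq I) k (A : set T) (B : set R) :
  uniq s -> k \notin s -> <<s cylinders X s >> A -> measurable B ->
  P (A `&` X k @^-1` B) = (P A * P (X k @^-1` B))%E.
Proof.
move=> us ks sA mB.
have mXB : measurable (X k @^-1` B) by exact: measurable_funPTI.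
have pB : (0 <= fine (P (X k @^-1` B)))%R by rewrite fine_ge0.
have -> : (P A * P (X k @^-1` B) = mscale (NngNum pB) P A)%E.
  by rewrite /mscale/= fineK ?fin_num_measure// muleC.
rewrite -[LHS]/(mrestr P mXB A).
apply: (g_sigma_algebra_measure_unique (cylinders X s)
  (@cylinders_measurable s) (fun=> setT)) => //.
- move=> _; exists (fun=> setT); first by move=> _; exact: measurableT.
  by apply/seteqP; split.
- by rewrite bigcup_const//; exists 0%N.
- move=> _ _ [A1 mA1 ->] [A2 mA2 ->]; exists (fun k => A1 k `&` A2 k).
    by move=> j; exact: measurableI.
  apply/seteqP; split=> w /=.
    by move=> [h1 h2] j js; split; [exact: h1|exact: h2].
  by move=> h; split => j /h[].
- move=> _ [C mC ->].
  set C0 := [set w | _].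
  change (P (C0 `&` X k @^-1` B) = (fine (P (X k @^-1` B)))%:E * P C0)%E.
  rewrite fineK ?fin_num_measure// /C0.
  have -> : [set w | forall j, j \in s -> C j (X j w)] `&` X k @^-1` B =
      [set w | forall j, j \in k :: s -> (if j == k then B else C j) (X j w)].
    apply/seteqP; split=> w /=.
      move=> [h Bw] j; rewrite inE; case: eqP => [-> //|_ /=]; exact: h.
    move=> h; split; last by have := h k (mem_head _ _); rewrite eqxx.
    move=> j js; have := h j; rewrite inE js orbT => /(_ isT).
    by case: eqP => // jk; rewrite -jk js in ks.
  have uks : uniq (k :: s) by rewrite /= ks.
  have mBC j : measurable (if j == k then B else C j) by case: ifP.
  rewrite (indepX uks mBC) (indepX us mC) muleC.
  rewrite big_cons eqxx muleC; congr (_ * _)%E; rewrite big_seq [RHS]big_seq.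
  by apply: eq_bigr => j js; case: eqP => // jk; rewrite -jk js in ks.
- move=> _; change (P (setT `&` X k @^-1` B) < +oo)%E.
  by rewrite setTI (le_lt_trans (probability_le1 _ _)) ?ltry.
Qed.

(** The pair formed by [X k] and the identity into the sub-sigma-algebra has a product law; Tonelli
    then integrates out [X k] while all that depends on [s] stays frozen. *)
Lemma integral_independent (s : seq I) k (F : generated X s * R -> \bar R) :
  uniq s -> k \notin s -> measurable_fun setT F -> (forall z, 0 <= F z)%E ->
  (\int[P]_w F (w, X k w) = \int[P]_w \int[distribution P (X k)]_x F (w, x))%E.
Proof.
move=> us ks mF F0.
have mid := @measurable_fun_generated_id s.
pose idX : {mfun T >-> generated X s} :=
  HB.pack (id : T -> generated X s) (isMeasurableFun.Build _ _ _ _ _ mid).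
have mZ : measurable_fun setT (fun w : T => ((w : generated X s), X k w)).
  by apply: measurable_fun_pair => //; exact: measurable_funP.
pose Z : {mfun T >-> (generated X s * R)%type} :=
  HB.pack (fun w : T => ((w : generated X s), X k w))
    (isMeasurableFun.Build _ _ _ _ _ mZ).
have := @ge0_integral_distribution _ _ _ _ _ P Z F mF F0.
rewrite /comp /= => <-.
transitivity (\int[distribution P idX \x distribution P (X k)]_z F z)%E.
  apply: eq_measure_integral => C mC _; apply/esym.
  apply: product_measure_unique => // A B mA mB.
  rewrite /distribution /pushforward /=.
  by rewrite -(generated_independent us ks mA mB).
rewrite fubini_tonelli1// ge0_integral_distribution//.
- exact: measurable_fun_fubini_tonelli_F.
- by move=> w; apply: integral_ge0 => x _; exact: F0.
Qed.

End independence.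

(** * Measurability of inverses, square roots and [heat] *)

Section measurability.
Context d (T : measurableType d) (R : realType).
Implicit Types f g : T -> R.

Lemma measurable_invr f : measurable_fun setT f ->
  measurable_fun setT (fun x => (f x)^-1).
Proof.
(* Squaring makes the base of [powR] nonnegative; the identity persists at the zeros of [f] because
   [0^-1 = 0]. *)
move=> mf; rewrite (_ : (fun _ => _) = (fun x => f x * powR (f x ^+ 2) (-1))).
  apply: measurable_funM => //.
  apply: (@measurableT_comp _ _ _ _ _ _ (@powR R ^~ (-1))).
    exact: measurable_powR.
  exact: measurable_funX.
apply/funext => x; have [->|fx0] := eqVneq (f x) 0;
  first by rewrite invr0 mul0r.
by rewrite powR_inv1 ?sqr_ge0// expr2 invfM mulrA divff// mul1r.
Qed.

Lemma measurable_sqrtr f : measurable_fun setT f ->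
  measurable_fun setT (fun x => Num.sqrt (f x)).
Proof.
apply: measurableT_comp; apply: continuous_measurable_fun;
  exact: sqrt_continuous.
Qed.

Lemma measurable_heat l f g : measurable_fun setT f -> measurable_fun setT g ->
  measurable_fun setT (fun x => heat l (f x) (g x)).
Proof.
move=> mf mg; rewrite /heat.
have m1 : measurable_fun setT (fun x => 1 + l * f x).
  by apply: measurable_funD => //; exact: measurable_funM.
apply: measurable_funM; last by apply: measurable_invr; exact: measurable_sqrtr.
apply: measurableT_comp => //; apply: measurable_funM.
  by apply: measurable_funM => //; exact: measurable_funX.
by apply: measurable_invr; exact: measurable_funM.
Qed.

Lemma measurable_sumr (I : Type) (s : seq I) (F : I -> T -> R) :
  (forall i, measurable_fun setT (F i)) ->
  measurable_fun setT (fun x => \sum_(i <- s) F i x).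
Proof. by move=> mF; exact: measurable_sum. Qed.

End measurability.

(* [normal_prob] lives on [measurableTypeR R], whose display differs from that
   of [R]; pushing forward along the identity reconciles the two. *)
Lemma integral_distribution_normal d (T : measurableType d) (R : realType)
    (P : probability T R) (X : {RV P >-> R}) (f : R -> \bar R) :
  distribution P X = normal_prob 0 1 :> (set R -> \bar R) ->
  measurable_fun setT f -> (forall x, 0 <= f x)%E ->
  (\int[distribution P X]_x f x = \int[normal_prob 0 1]_x f x)%E.
Proof.
move=> XE mf f0.
have mid : measurable_fun setT (id : measurableTypeR R -> R).
  by move=> _ A mA; rewrite setTI preimage_id.
transitivity (\int[pushforward (normal_prob 0 1) (id : measurableTypeR R -> R)]_x f x)%E.
  by apply: eq_measure_integral => A mA _; exact: (congr1 (@^~ A) XE).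
by rewrite ge0_integral_pushforward.
Qed.

(** * Gaussian combinations with independent random coefficients *)

Section gaussian_independence.
Context d (T : measurableType d) (R : realType) (P : probability T R).
Context (I : eqType) (X : I -> {RV P >-> R}).
Hypothesis indepX : mutually_independent X.
Hypothesis gaussX : forall k,
  distribution P (X k) = normal_prob 0 1 :> (set R -> \bar R).

Lemma measurable_sum_generated (J : eqType) (e : J -> I) (s : seq J)
    (K : seq I) (c : J -> T -> R) :
  (forall k, measurable_fun setT (c k : generated X K -> R)) ->
  measurable_fun setT
    ((fun w => \sum_(k <- s) c k w * X (e k) w) :
      generated X (map e s ++ K) -> R).
Proof.
move=> mc.
(* Measurability of [X (e k)] is available for k in [s] only, so other summands are replaced by 0
   before quantifying over all indices. *)
rewrite (_ : (fun w => _) =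
   (fun w => \sum_(k <- s) (if k \in s then c k w * X (e k) w else 0))).
  apply: measurable_sumr => k; case: (boolP (k \in s)) => [ks|_];
    last exact: measurable_cst.
  apply: measurable_funM.
    by apply: measurable_fun_generatedW (mc k) => j; rewrite mem_cat orbC => ->.
  by apply: measurable_fun_generated; rewrite mem_cat map_f.
by apply/funext => w; rewrite big_seq [RHS]big_seq; apply: eq_bigr => k ->.
Qed.

(* The variables indexed by [s] are integrated out one at a time; each moves its
   squared coefficient into the time argument of [heat]. *)
Lemma expectation_heat (J : eqType) (e : J -> I) (l : R) (K : seq I)
    (s : seq J) (h V : T -> R) (c : J -> T -> R) :
  -1 < l -> uniq (map e s ++ K) ->
  measurable_fun setT (h : generated X K -> R) ->
  measurable_fun setT (V : generated X K -> R) ->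
  (forall k, measurable_fun setT (c k : generated X K -> R)) ->
  (forall w, 0 <= h w) -> (forall w, 0 <= V w) ->
  (forall w, V w + \sum_(k <- s) c k w ^+ 2 <= 1) ->
  (\int[P]_w (h w * heat l (V w) (\sum_(k <- s) c k w * X (e k) w))%:E =
   \int[P]_w (h w * heat l (V w + \sum_(k <- s) c k w ^+ 2) 0)%:E)%E.
Proof.
move=> l1 + mh + mc h0; elim: s V => [|k s IH] V usK mV V0 V1.
  by apply: eq_integral => w _; rewrite !big_nil addr0.
move: usK => /= /andP[ksK usK].
have c0 w : 0 <= c k w ^+ 2 by exact: sqr_ge0.
have s0 w : 0 <= \sum_(j <- s) c j w ^+ 2.
  by apply: sumr_ge0 => j _; exact: sqr_ge0.
have V1s w : V w + c k w ^+ 2 + \sum_(j <- s) c j w ^+ 2 <= 1.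
  by have := V1 w; rewrite big_cons addrA.
under [RHS]eq_integral do rewrite big_cons addrA.
(* The induction hypothesis is used backwards on the right-hand side, starting from the time reached
   after variable [k]; only the integral over [X (e k)] then separates the two sides. *)
rewrite -(IH (fun w => V w + c k w ^+ 2))//; last 2 first.
- by apply: measurable_funD => //; exact: measurable_funX.
- by move=> w; rewrite addr_ge0.
have msK f : measurable_fun setT (f : generated X K -> R) ->
    measurable_fun setT (fun z : generated X (map e s ++ K) * R => f z.1).
  move=> mf; apply: measurableT_comp (measurable_fst) => /=.
  by apply: measurable_fun_generatedW mf => j; rewrite mem_cat orbC => ->.
pose F (z : generated X (map e s ++ K) * R) := (h z.1 *
  heat l (V z.1) (c k z.1 * z.2 + \sum_(j <- s) c j z.1 * X (e j) z.1))%:E.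
have mF : measurable_fun setT F.
  apply/measurable_EFinP; apply: measurable_funM; first exact: msK.
  apply: measurable_heat; first exact: msK.
  apply: measurable_funD; first by apply: measurable_funM => //; exact: msK.
  apply: (@measurableT_comp _ _ _ _ _ _
    (fun w : generated X (map e s ++ K) => \sum_(j <- s) c j w * X (e j) w)) => //.
  exact: measurable_sum_generated.
have F0 z : (0 <= F z)%E by rewrite lee_fin mulr_ge0 ?heat_ge0.
under eq_integral do rewrite big_cons.
rewrite (integral_independent indepX usK ksK mF F0).
apply: eq_integral => w _.
transitivity (\int[normal_prob 0 1]_x F (w, x))%E.
  apply: integral_distribution_normal; first exact: gaussX.
    exact: measurableT_comp mF (pair1_measurable _).
  by move=> x; exact: F0.
rewrite /F /=; under eq_integral do rewrite EFinM.
(* The total time stays in [0, 1], so [-1 < l] keeps the radicands positive even for negative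
   [l]. *)
have lV v : 0 <= v -> v <= 1 -> 0 < 1 + l * v.
  by move=> v0 v1; have [?|?] := leP 0 l; nra.
rewrite ge0_integralZl//.
- rewrite heat_comp ?EFinM//; first by apply: lV => //; have := V1s w;
    have := s0 w; have := c0 w; lra.
  by apply: lV; [rewrite addr_ge0|have := V1s w; have := s0 w; lra].
- apply/measurable_EFinP; apply: measurable_heat => //.
  by apply: measurable_funD => //; exact: measurable_funM.
- by move=> x _; rewrite lee_fin heat_ge0.
- by rewrite lee_fin.
Qed.

End gaussian_independence.

(** * The radius of information *)

Lemma nneseries_leP (R : realType) (u : nat -> R) (c : R) :
  (forall j, 0 <= u j) ->
  (\sum_(j <oo) (u j)%:E <= c%:E)%E <-> forall N, \sum_(j < N) u j <= c.
Proof.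
move=> u0; split=> [h N|h].
  rewrite -lee_fin; apply: le_trans h;
    rewrite -sumEFin -(big_mkord xpredT (EFin \o u)).
  by apply: nneseries_lim_ge => j _ _; rewrite lee_fin.
apply: lime_le; first by apply: is_cvg_nneseries => j _ _; rewrite lee_fin.
by apply: nearW => N; rewrite sumEFin lee_fin big_mkord.
Qed.

Lemma nneseries_geometric_le (R : realType) (a c : R) (u : nat -> R) :
  0 <= a -> a < 1 -> 0 <= c ->
  (forall l, 0 <= u l) -> (forall l, u l <= c * a ^+ l) ->
  (\sum_(l <oo) (u l)%:E <= (c / (1 - a))%:E)%E.
Proof.
move=> a0 a_lt1 c0 u0 uc; apply/(nneseries_leP _ u0) => N.
apply: (@le_trans _ _ (\sum_(l < N) c * a ^+ l)); first exact: ler_sum.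
have a1 : 0 < 1 - a by rewrite subr_gt0.
rewrite -mulr_sumr ler_wpM2l// -[leRHS]mul1r ler_pdivlMr//.
have := subrX1 a N; have := exprn_ge0 N a0.
by set Sa := \sum_(_ < _) _; set aN := a ^+ N; nra.
Qed.

Lemma l2norm_leP (R : realType) (x : nat -> R) (M : R) : 0 <= M ->
  (l2norm x <= M%:E)%E <-> forall N, \sum_(j < N) x j ^+ 2 <= M ^+ 2.
Proof.
move=> M0; rewrite -(@nneseries_leP _ (fun j => x j ^+ 2)); last by move=> j;
  exact: sqr_ge0.
rewrite /l2norm Lnorm_counting//.
under eq_eseriesr => j _.
  rewrite /= powR_mulrn// real_normK ?num_real//.
  over.
set S := (\sum_(_ <oo) _)%E.
have S0 : (0 <= S)%E.
  by apply: nneseries_ge0 => j _ _; rewrite lee_fin sqr_ge0.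
have SE : S = ((S `^ 2^-1) `^ 2)%E by rewrite -poweRrM mulVf// poweRe1.
have M2 : (M ^+ 2)%:E = (M%:E `^ 2)%E by rewrite poweR_EFin powR_mulrn.
have pos (y : \bar R) : (0 <= y)%E -> y \in `[0%E, +oo%E].
  by move=> y0; rewrite in_itv/= y0 leey.
split=> h.
  rewrite SE M2; apply: gt0_ler_poweR => //; apply: pos => //; exact: poweR_ge0.
have -> : M%:E = ((M ^+ 2)%:E `^ 2^-1)%E.
  by rewrite M2 -poweRrM mulfV// poweRe1.
by apply: gt0_ler_poweR => //; apply: pos => //; rewrite lee_fin sqr_ge0.
Qed.

(** * Worst-case error over the ellipsoid *)

Section ellipsoid.
Context (R : realType) (sigma : nat -> R).
Hypothesis sigma_gt0 : forall j, 0 < sigma j.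
Hypothesis sigma_noninc : nonincreasing_seq sigma.

Lemma ellipsoid_sumE (x : nat -> R) :
  ellipsoid_sum sigma x = (\sum_(j <oo) (((x j / sigma j) ^+ 2)%:E))%E.
Proof.
apply: eq_eseriesr => j _.
by rewrite inver gt_eqF// -EFinM -EFin_expe.
Qed.

Lemma sum_sqr_le (x : nat -> R) m c :
  (forall N, \sum_(j < N) (x j / sigma j) ^+ 2 <= c) ->
  forall N, \sum_(j < N) x (m + j)%N ^+ 2 <= sigma m ^+ 2 * c.
Proof.
move=> h N.
apply: (@le_trans _ _ (sigma m ^+ 2 * \sum_(j < N) (x (m + j)%N / sigma (m + j)%N) ^+ 2)).
  rewrite mulr_sumr; apply: ler_sum => j _.
  rewrite expr_div_n mulrCA ler_peMr ?sqr_ge0//.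
  rewrite ler_pdivlMr ?exprn_gt0// mul1r ler_sqr ?nnegrE ?(ltW (sigma_gt0 _))//.
  by apply: sigma_noninc; exact: leq_addr.
rewrite ler_wpM2l ?sqr_ge0//; apply: le_trans (h (m + N)%N).
by rewrite big_split_ord/= lerDr sumr_ge0// => j _; exact: sqr_ge0.
Qed.

(** Square-summability is automatic: [sum_sqr_le] from index 0 bounds the norm by [sigma 0]. *)
Lemma ellipsoidP (x : nat -> R) :
  ellipsoid sigma x <-> forall N, \sum_(j < N) (x j / sigma j) ^+ 2 <= 1.
Proof.
rewrite -(@nneseries_leP _ (fun j => (x j / sigma j) ^+ 2)) => [|j];
  last exact: sqr_ge0.
rewrite -ellipsoid_sumE; split => [[]//|h]; split => //.
rewrite /l2/=; apply: (@le_lt_trans _ _ (sigma 0)%:E); last exact: ltry.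
apply/l2norm_leP; first exact: ltW.
move=> N; have := @sum_sqr_le x 0 1; rewrite mulr1; apply => {}N.
apply: (nneseries_leP 1 (fun j => sqr_ge0 (x j / sigma j))).1.
by rewrite -ellipsoid_sumE.
Qed.

Lemma ellipsoidN (x : nat -> R) : ellipsoid sigma x -> ellipsoid sigma (\- x).
Proof.
move=> /ellipsoidP h; apply/ellipsoidP => N; apply: le_trans (h N).
by apply: ler_sum => j _; rewrite mulNr sqrrN.
Qed.

(** Any [phi] returns the same point for x and -x, so one of its two errors is at least the norm of
    x. The last hypothesis expresses that [r] is at most this norm. *)
Lemma radius_ge n (G : 'I_n -> nat -> R) (x : nat -> R) (r : R) :
  ellipsoid sigma x -> info G x = info G (\- x) ->
  (forall M, (l2norm x <= M%:E)%E -> r <= M) ->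
  (r%:E <= radius sigma G)%E.
Proof.
move=> Ex Gx xr; apply: le_ereal_inf_tmp => _ [phi _ <-].
set S := ereal_sup _; set p := phi (info G x).
have h1 : (l2norm (p \- x)%R <= S)%E by apply: ereal_sup_ubound; exists x.
have h2 : (l2norm (p \- (\- x))%R <= S)%E.
  by apply: ereal_sup_ubound; exists (\- x) => //; rewrite -?Gx//;
    exact: ellipsoidN.
have S0 : (0 <= S)%E by apply: le_trans h1; exact: Lnorm_ge0.
case: S S0 h1 h2 => [M| |]//; rewrite ?leey// !lee_fin => M0.
move=> /(l2norm_leP _ M0) h1 /(l2norm_leP _ M0) h2.
apply: xr; apply/l2norm_leP => // N.
have := h1 N; have := h2 N => {}h2 {}h1.
(* parallelogram law: x is the half-difference of p + x and p - x *)
suff : \sum_(j < N) (x j ^+ 2 + x j ^+ 2) <= M ^+ 2 + M ^+ 2.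
  by rewrite big_split/=; lra.
apply: le_trans (lerD h1 h2); rewrite -big_split/=; apply: ler_sum => j _.
by have := sqr_ge0 (p j); lra.
Qed.

(** Let [phi] return any element of the ellipsoid compatible with the data; its error is then a
    distance between two elements with equal information. *)
Lemma radius_le n (G : 'I_n -> nat -> R) (M : R) :
  (forall x y, ellipsoid sigma x -> ellipsoid sigma y -> info G x = info G y ->
     (l2norm (y \- x)%R <= M%:E)%E) ->
  (radius sigma G <= M%:E)%E.
Proof.
move=> h.
(* The default value of [xget] must also lie in the ellipsoid, so that [phi] takes values in
   [l2]. *)
have E0 : ellipsoid sigma (cst 0).
  by apply/ellipsoidP => N; rewrite big1// => j _; rewrite mul0r expr0n.
pose phi (b : 'I_n -> option R) : nat -> R :=
  xget (cst 0) [set y | ellipsoid sigma y /\ info G y = b].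
have phiE b : ellipsoid sigma (phi b) by rewrite /phi; case: xgetP => [y _ []|].
apply: (@le_trans _ _ (ereal_sup [set l2norm (phi (info G x) \- x) | x in ellipsoid sigma])).
  by apply: ereal_inf_lbound; exists phi => // b _; have [] := phiE b.
apply: ge_ereal_sup => _ [x Ex <-]; apply: h => //.
rewrite /phi; case: xgetP => [y _ [//]|/(_ x) /=]; tauto.
Qed.

(** The constant 4 comes from (s - t)^2 <= 2 s^2 + 2 t^2. *)
Lemma ellipsoid_diff (x y : nat -> R) :
  ellipsoid sigma x -> ellipsoid sigma y ->
  forall N, \sum_(j < N) ((y \- x) j / sigma j) ^+ 2 <= 4.
Proof.
move=> /ellipsoidP hx /ellipsoidP hy N.
apply: (@le_trans _ _ (\sum_(j < N) (2 * (x j / sigma j) ^+ 2 + 2 * (y j / sigma j) ^+ 2))).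
  apply: ler_sum => j _ /=; rewrite mulrBl.
  by have := sqr_ge0 (x j / sigma j + y j / sigma j); lra.
by rewrite big_split/= -!mulr_sumr; have := hx N; have := hy N; lra.
Qed.

End ellipsoid.

(** * A truncated reciprocal with computable expectation *)

Lemma heat_v0 (R : realType) (l y : R) : heat l 0 y = expR (- l * y ^+ 2 / 2).
Proof. by rewrite /heat !mulr0 addr0 mulr1 sqrtr1 divr1. Qed.

Lemma heat_y0 (R : realType) (l v : R) : heat l v 0 = (Num.sqrt (1 + l * v))^-1.
Proof. by rewrite /heat expr0n/= mulr0 mul0r expR0 mul1r. Qed.

(* By [weight_ge], it dominates min(1/|s|, a^-m); the i-th summand handles
   |s| <= a^i and has expectation at most 2 / a for a standard normal s. *)
Definition weight (R : realType) (a : R) (m : nat) (s : R) : R :=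
  1 + \sum_(i < m) 2 / a * (a ^+ i)^-1 * heat ((a ^+ i) ^- 2) 0 s.

Section weight.
Context (R : realType) (a : R).
Hypotheses (a_gt0 : 0 < a) (a_lt1 : a < 1).

Lemma weight_ge1 m s : 1 <= weight a m s.
Proof.
rewrite lerDl sumr_ge0// => i _; apply: mulr_ge0; last exact: heat_ge0.
by rewrite ltW// mulr_gt0 ?divr_gt0 ?invr_gt0 ?exprn_gt0.
Qed.

(** Induction on [m]. The first alternative persists because the weight grows. From the second, |s|
    > a^m yields the first, while for |s| <= a^m the new summand alone reaches a^-(m+1). *)
Lemma weight_ge m s :
  1 <= `|s| * weight a m s \/ (a ^+ m)^-1 <= weight a m s.
Proof.
elim: m => [|m IH]; first by right; rewrite expr0 invr1 weight_ge1.
have am0 : 0 < a ^+ m by rewrite exprn_gt0.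
have WS : weight a m.+1 s =
    weight a m s + 2 / a * (a ^+ m)^-1 * heat ((a ^+ m) ^- 2) 0 s.
  by rewrite /weight big_ord_recr/= addrA.
set r := 2 / a * _ * _ in WS.
have r0 : 0 <= r.
  apply: mulr_ge0; last exact: heat_ge0.
  by rewrite ltW// mulr_gt0 ?divr_gt0 ?invr_gt0.
have W1 := weight_ge1 m s; have s0 := normr_ge0 s.
case: IH => [h|h]; first by left; rewrite WS; nra.
have [sm|sm] := ltP (a ^+ m) `|s|.
  left; rewrite WS; apply: (@le_trans _ _ (a ^+ m * (a ^+ m)^-1)).
    by rewrite divff ?gt_eqF.
  by apply: ler_pM; rewrite ?invr_ge0 ?(ltW am0) ?(ltW sm)//; lra.
right; rewrite WS exprS invfM.
suff : a^-1 * (a ^+ m)^-1 <= r by lra.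
set e := - (a ^+ m) ^- 2 * s ^+ 2 / 2.
(* Here |s| <= a^m enters; then 2 exp(e) >= 2 (1 + e) >= 1, which explains the factor 2 in
   [weight]. *)
have e_ge : - 2^-1 <= e.
  rewrite /e !mulNr lerN2 ler_pdivrMr// mulVf// mulrC ler_pdivrMr ?exprn_gt0// mul1r.
  by rewrite -real_normK ?num_real// ler_sqr ?nnegrE ?(ltW am0).
rewrite /r heat_v0 -/e.
have -> : 2 / a * (a ^+ m)^-1 * expR e = a^-1 * (a ^+ m)^-1 * (2 * expR e) by ring.
rewrite ler_peMr//; first by rewrite ltW// mulr_gt0 ?invr_gt0.
by have := expR_ge1Dx e; lra.
Qed.

End weight.

(** The column index comes first, so that [cof G j] is the cofactor vector along column [j]. Only
    the leading square block of [G] enters. *)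
Definition cof (R : realType) (m : nat) (G : 'I_m -> nat -> R)
    (j i : 'I_m) : R :=
  cofactor (\matrix_(i, j) G i j) i j.

Definition cof_norm2 (R : realType) (m : nat) (G : 'I_m -> nat -> R)
    (j : 'I_m) : R :=
  \sum_i cof G j i ^+ 2.

(* Column [l] paired with the normalized [j]-th cofactor vector; 0 when all
   these cofactors vanish. *)
Definition cof_proj (R : realType) (m : nat) (G : 'I_m -> nat -> R) (j : 'I_m)
    (l : nat) : R :=
  \sum_i cof G j i / Num.sqrt (cof_norm2 G j) * G i l.

Lemma le_norm_of_cvg0 (R : realType) (t A : R) (e : nat -> R) :
  (fun n => t + e n) @ \oo --> (0 : R) -> (forall n, `|e n| <= A) -> `|t| <= A.
Proof.
move=> h eA; have {}h : (fun n => `|t + e n|) @ \oo --> `|0 : R|.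
  exact: cvg_norm.
rewrite normr0 in h; rewrite -subr_le0; apply: (cvgr_to_ge h);
  apply: nearW => n.
have := ler_normB (t + e n) (e n); rewrite addrK; have := eA n; lra.
Qed.

(** * One coordinate of the difference of two elements with equal information *)

Section coordinates.
Context (R : realType) (sigma : nat -> R) (a C : R) (m : nat).
Hypotheses (sigma_gt0 : forall j, 0 < sigma j) (a_gt0 : 0 < a) (a_lt1 : a < 1).
Hypothesis (sigma_le : forall j, sigma j <= C * a ^+ j.+1).
Hypothesis sigma_noninc : nonincreasing_seq sigma.
Context (G : 'I_m -> nat -> R).
Let A : 'M[R]_m := \matrix_(i, j) G i j.

(** Entry (j, i) of adj(A) A = det(A) I. *)
Lemma cof_orth (j i : 'I_m) : \sum_k cof G j k * G k i = \det A *+ (j == i).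
Proof.
have /matrixP/(_ j i) := mul_adj_mx A; rewrite !mxE => <-.
by apply: eq_bigr => k _; rewrite !mxE.
Qed.

(** If all cofactors along column [j] vanished, so would the expansion of the determinant along
    it. *)
Lemma cof_norm2_gt0 j : \det A != 0 -> 0 < cof_norm2 G j.
Proof.
move=> D0; rewrite lt_neqAle sumr_ge0 => [|i _]; last exact: sqr_ge0.
rewrite andbT eq_sym; apply: contra D0 => /eqP N0.
have c0 i : cof G j i = 0.
  apply/eqP; rewrite -sqrf_eq0; apply/eqP/le_anti; rewrite sqr_ge0 andbT -N0.
  by rewrite /cof_norm2 (bigD1 i)//= lerDl sumr_ge0// => k _; exact: sqr_ge0.
have := cof_orth j j; rewrite eqxx mulr1n => <-.
by rewrite big1// => k _; rewrite c0 mul0r.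
Qed.

(** Absolute convergence, by AM-GM applied to g x = (sigma g) (x / sigma). *)
Lemma info_series_cvg (g x : nat -> R) (q : R) :
  (forall N, \sum_(l < N) (sigma l * g l) ^+ 2 <= q) ->
  (forall N, \sum_(l < N) (x l / sigma l) ^+ 2 <= 1) ->
  cvgn (series (fun l => g l * x l)).
Proof.
move=> gq x1; apply: normed_cvg; apply: nondecreasing_is_cvgn.
  by apply: nondecreasing_series => l _ _; exact: normr_ge0.
exists ((q + 1) / 2) => _ [N _ <-].
rewrite /normed_series_of /series/= big_mkord.
apply: (@le_trans _ _ (\sum_(l < N) ((sigma l * g l) ^+ 2 + (x l / sigma l) ^+ 2) / 2)).
  apply: ler_sum => l _.
  have -> : g l * x l = (sigma l * g l) * (x l / sigma l).
    by field; rewrite gt_eqF.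
  set p := sigma l * g l; set r := x l / sigma l; rewrite normrM.
  have := sqr_ge0 (`|p| - `|r|); rewrite sqrrB !real_normK ?num_real//; lra.
rewrite -mulr_suml big_split/=; have := gq N; have := x1 N; lra.
Qed.

(** Combining the rows with the normalized cofactor vector eliminates the first [m] coordinates of y
    - x except the [j]-th, leaving a tail controlled by [t]. The weight stands for division by
    [cof_proj G j j], which may be tiny. *)
Lemma coordinate_le (x y : nat -> R) (q t : R) (j : 'I_m) :
  \det A != 0 -> 0 < C -> 0 <= t ->
  ellipsoid sigma x -> ellipsoid sigma y -> info G x = info G y ->
  (forall i N, \sum_(l < N) (sigma l * G i l) ^+ 2 <= q) ->
  (forall N, \sum_(l < N)
     a ^- m * sigma (m + l)%N ^+ 2 * cof_proj G j (m + l) ^+ 2 <= t) ->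
  `|y j - x j| <= 2 * (1 + C) * weight a m (cof_proj G j j) * (t + a ^+ m).
Proof.
move=> D0 C0 t0 Ex Ey Gxy Gq Tt.
have am0 : 0 < a ^+ m by rewrite exprn_gt0.
have Nj := cof_norm2_gt0 j D0.
have zE := ellipsoid_diff sigma_gt0 sigma_noninc Ex Ey.
pose z := y \- x; rewrite -[y j - x j]/(z j).
have rowz i : series (fun l => G i l * z l) @ \oo --> (0 : R).
  have cx := info_series_cvg (Gq i) ((ellipsoidP sigma_gt0 sigma_noninc x).1 Ex).
  have cy := info_series_cvg (Gq i) ((ellipsoidP sigma_gt0 sigma_noninc y).1 Ey).
  have := congr1 (fun f => f i) Gxy; rewrite /info !asboolT// => -[lim_xy].
  rewrite (_ : series _ = series (fun l => G i l * y l) \- series (fun l => G i l * x l)).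
    rewrite [X in _ --> X](_ : _ = limn (series (fun l => G i l * y l)) -
      limn (series (fun l => G i l * x l))); last by rewrite lim_xy subrr.
    exact: cvgB.
  apply/funext => N; rewrite /= /series/= -sumrB.
  by apply: eq_bigr => l _; rewrite -mulrBr.
(* The combination of the partial sums is read at N + m: its first [m] terms reduce to the [j]-th by
   orthogonality, and the rest are the tail. *)
have combz : (fun N => cof_proj G j j * z j +
    \sum_(l < N) cof_proj G j (m + l) * z (m + l)%N) @ \oo --> (0 : R).
  pose F N := \sum_i cof G j i / Num.sqrt (cof_norm2 G j) *
      series (fun l => G i l * z l) N.
  have F0 : F @ \oo --> (0 : R).
    rewrite [X in _ --> X](_ : _ =
      \sum_i cof G j i / Num.sqrt (cof_norm2 G j) * 0); last first.
      by rewrite big1// => i _; rewrite mulr0.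
    apply: cvg_big => [|i _]; first exact: add_continuous.
    by apply: cvgMr; exact: rowz.
  rewrite (_ : (fun N => _) = fun N => F (N + m)%N).
    by move: F0; rewrite -(cvg_shiftn m).
  apply/funext => N; rewrite addnC.
  transitivity (\sum_(l < m + N) cof_proj G j l * z l).
    rewrite big_split_ord/=; congr (_ + _);
      rewrite (bigD1 j)//= big1 ?addr0// => l lj.
    rewrite /cof_proj; under eq_bigr do rewrite mulrAC.
    by rewrite -mulr_suml cof_orth eq_sym (negbTE lj) mulr0n !mul0r.
  rewrite /F; under [LHS]eq_bigr do rewrite /cof_proj mulr_suml.
  rewrite exchange_big/=; apply: eq_bigr => i _.
  by rewrite seriesEord/= mulr_sumr; apply: eq_bigr => l _; rewrite mulrA.
(* AM-GM and [ellipsoid_diff] give (t + 4 a^m) / 2, which is at most this bound. *)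
have zt : `|cof_proj G j j * z j| <= 2 * (t + a ^+ m).
  (* AM-GM: |p r| <= (a^-m (u p)^2 + a^m (r / u)^2) / 2 with u = sigma_{m+l} *)
  apply: le_norm_of_cvg0 combz _ => N; apply: le_trans (ler_norm_sum _ _ _) _.
  apply: (@le_trans _ _ (\sum_(l < N)
      (a ^- m * sigma (m + l)%N ^+ 2 * cof_proj G j (m + l) ^+ 2 +
       a ^+ m * (z (m + l)%N / sigma (m + l)%N) ^+ 2) / 2)).
    apply: ler_sum => l _.
    set p := cof_proj _ _ _; set r := z _; set u := sigma _.
    have u0 : 0 < u by exact: sigma_gt0.
    rewrite -subr_ge0 normrM.
    have -> : (a ^- m * u ^+ 2 * p ^+ 2 + a ^+ m * (r / u) ^+ 2) / 2 - `|p| * `|r| =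
        a ^- m * (u * `|p| - a ^+ m * (`|r| / u)) ^+ 2 / 2.
      rewrite -(real_normK (num_real p)) expr_div_n -(real_normK (num_real r)).
      by field; rewrite !gt_eqF.
    by rewrite mulr_ge0// mulr_ge0 ?sqr_ge0// invr_ge0 ltW.
  rewrite -mulr_suml big_split/= -mulr_sumr.
  have h : \sum_(l < N) (z (m + l)%N / sigma (m + l)%N) ^+ 2 <= 4.
    apply: le_trans (zE (m + N)%N).
    by rewrite big_split_ord/= lerDr sumr_ge0// => l _; exact: sqr_ge0.
  have := Tt N; nra.
(* The a priori bound 2 sigma_j, for the case where dividing by [cof_proj G j j] is too costly. *)
have zj : `|z j| <= 2 * C.
  have sj : sigma j <= C.
    apply: le_trans (sigma_le j) _; rewrite ler_piMr ?(ltW C0)//.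
    by rewrite exprn_ile1 ?ltW.
  have : (z j / sigma j) ^+ 2 <= 2 ^+ 2.
    rewrite -natrX; apply: le_trans (zE j.+1); rewrite big_ord_recr/= lerDr.
    by apply: sumr_ge0 => l _; exact: sqr_ge0.
  rewrite -real_normK ?num_real// ler_sqr ?nnegrE// normrM normfV.
  rewrite (gtr0_norm (sigma_gt0 j)) ler_pdivrMr// => h.
  by apply: le_trans h _; rewrite ler_pM2l.
set s := cof_proj G j j in zt *; have W1 := weight_ge1 a_gt0 m s.
rewrite normrM in zt; have z0 := normr_ge0 (z j).
(* Either the weight dominates 1/|s| and [zt] is divided by |s|, or it dominates a^-m and 2 C = 2 C
   a^-m a^m suffices. The factor 1 + C covers both cases. *)
case: (weight_ge a_gt0 m s) => h.
  apply: (@le_trans _ _ (`|s| * `|z j| * weight a m s)).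
    by rewrite mulrAC ler_peMl.
  apply: (@le_trans _ _ (2 * (t + a ^+ m) * weight a m s));
    first by rewrite ler_wpM2r//; lra.
  rewrite -subr_ge0 [X in 0 <= X](_ : _ =
    2 * C * weight a m s * (t + a ^+ m)); last by ring.
  by apply: mulr_ge0; [apply: mulr_ge0|]; lra.
apply: (le_trans zj).
have -> : 2 * C = 2 * C * (a ^+ m)^-1 * a ^+ m by rewrite mulfVK ?gt_eqF.
apply: ler_pM; rewrite ?mulr_ge0 ?invr_ge0 ?(ltW C0) ?(ltW am0)//; last by lra.
by apply: ler_pM; rewrite ?mulr_ge0 ?invr_ge0 ?(ltW C0) ?(ltW am0)//; lra.
Qed.

End coordinates.

(** The bound of [coordinate_le] with the full tail series, possibly infinite, in place of [t]. The
    indicator is 1 when the leading block is nonsingular; it matches [expectation_heat_normalized],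
    where a zero vector cannot be normalized. *)
Definition coordinate_bound (R : realType) (sigma : nat -> R) (a C : R)
    (m : nat) (G : 'I_m -> nat -> R) (j : 'I_m) : \bar R :=
  ((2 * (1 + C) * (cof_norm2 G j != 0)%:R * weight a m (cof_proj G j j))%:E *
   (\sum_(l <oo) (a ^- m * sigma (m + l)%N ^+ 2 * cof_proj G j (m + l) ^+ 2)%:E
    + (a ^+ m)%:E))%E.

(* If the first sum is finite, every series defining G x converges for x in the
   ellipsoid, so no component of the information is NaN. *)
Definition radius_bound (R : realType) (sigma : nat -> R) (a C : R) (m : nat)
    (G : 'I_m -> nat -> R) : \bar R :=
  (\sum_(i < m) \sum_(l <oo) (a ^+ m * (sigma l * G i l) ^+ 2)%:E +
   \sum_(j < m) coordinate_bound sigma a C G j + (2 * sigma m)%:E)%E.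

Lemma le_sume (R : realDomainType) (I : finType) (F : I -> \bar R) (i : I) :
  (forall i, 0 <= F i)%E -> (F i <= \sum_i F i)%E.
Proof. by move=> F0; rewrite (bigD1 i)//= leeDl// sume_ge0. Qed.

Lemma sum_sqr_le_sqr_sum (R : realDomainType) (m : nat) (b : 'I_m -> R) :
  (forall i, 0 <= b i) -> \sum_i b i ^+ 2 <= (\sum_i b i) ^+ 2.
Proof.
elim: m b => [|m IH] b b0; first by rewrite !big_ord0 expr0n.
rewrite !big_ord_recr/=; have := IH _ (fun i => b0 (widen_ord (leqnSn m) i)).
have : 0 <= \sum_(i < m) b (widen_ord (leqnSn m) i) by exact: sumr_ge0.
by have := b0 ord_max; nra.
Qed.

(** * Pointwise upper bound for a nonsingular leading block *)

Section radius_bounds.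
Context (R : realType) (sigma : nat -> R) (a C : R) (m : nat).
Hypotheses (sigma_gt0 : forall j, 0 < sigma j) (a_gt0 : 0 < a) (a_lt1 : a < 1).
Hypothesis (C_gt0 : 0 < C).
Hypothesis (sigma_le : forall j, sigma j <= C * a ^+ j.+1).
Hypothesis sigma_noninc : nonincreasing_seq sigma.
Context (G : 'I_m -> nat -> R).

Let am0 : 0 < a ^+ m. Proof. by rewrite exprn_gt0. Qed.

Let row_ge0 i : (0 <= \sum_(l <oo) (a ^+ m * (sigma l * G i l) ^+ 2)%:E)%E.
Proof.
by apply: nneseries_ge0 => l _ _; rewrite lee_fin mulr_ge0 ?sqr_ge0 ?ltW.
Qed.

Let term_ge0 j l :
  0 <= a ^- m * sigma (m + l)%N ^+ 2 * cof_proj G j (m + l) ^+ 2.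
Proof.
by apply: mulr_ge0 (sqr_ge0 _); apply: mulr_ge0 (sqr_ge0 _);
  rewrite invr_ge0 ltW.
Qed.

Lemma coordinate_bound_ge0 j : (0 <= coordinate_bound sigma a C G j)%E.
Proof.
apply: mule_ge0.
  rewrite lee_fin; apply: mulr_ge0.
    by apply: mulr_ge0 (ler0n _ _); have := C_gt0; lra.
  by have := weight_ge1 a_gt0 m (cof_proj G j j); lra.
apply: adde_ge0; last by rewrite lee_fin ltW.
by apply: nneseries_ge0 => l _ _; rewrite lee_fin term_ge0.
Qed.

(** An infinite bound is trivial. A finite one makes each of its series finite, so [coordinate_le]
    controls the first [m] coordinates of a difference, and [sum_sqr_le] the others. *)
Lemma radius_le_bound : \det (\matrix_(i, j) G i j : 'M[R]_m) != 0 ->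
  (radius sigma G <= radius_bound sigma a C G)%E.
Proof.
move=> D0.
have S0 : (0 <= \sum_(i < m) \sum_(l <oo) (a ^+ m * (sigma l * G i l) ^+ 2)%:E)%E.
  by apply: sume_ge0.
have T0 : (0 <= \sum_(j < m) coordinate_bound sigma a C G j)%E.
  by apply: sume_ge0 => j _; exact: coordinate_bound_ge0.
have sm0 := sigma_gt0 m.
have U0 : (0 <= (2 * sigma m)%:E)%E by rewrite lee_fin mulr_ge0// ltW.
have S_le : (\sum_(i < m) \sum_(l <oo) (a ^+ m * (sigma l * G i l) ^+ 2)%:E <=
    radius_bound sigma a C G)%E.
  by rewrite /radius_bound -addeA leeDl// adde_ge0.
have TU_le : (\sum_(j < m) coordinate_bound sigma a C G j + (2 * sigma m)%:E <=
    radius_bound sigma a C G)%E by rewrite /radius_bound -addeA leeDr.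
have T_le : (\sum_(j < m) coordinate_bound sigma a C G j <=
    radius_bound sigma a C G)%E by apply: le_trans TU_le; rewrite leeDl.
case BE : radius_bound S_le TU_le T_le => [B| |]; rewrite ?leey//; last first.
  by move=> /(le_trans S0).
move=> S_le TU_le T_le.
(* Only some finite bound on the rows matters here; the factor a^m in [radius_bound] keeps their
   expectation of the right order. *)
have Gq i N : \sum_(l < N) (sigma l * G i l) ^+ 2 <= B / a ^+ m.
  rewrite ler_pdivlMr// mulrC mulr_sumr.
  apply: (@nneseries_leP _ (fun l => a ^+ m * (sigma l * G i l) ^+ 2) B _).1.
    by move=> l; rewrite mulr_ge0 ?sqr_ge0 ?ltW.
  by apply: le_trans S_le; exact: (le_sume i row_ge0).
(* The prefactor is positive, so a finite coordinate bound forces a finite tail series, with value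
   [t]. *)
have /choice[t /all_and3[t0 Tt cE]] j : exists t : R, [/\ 0 <= t,
    (forall N, \sum_(l < N)
      a ^- m * sigma (m + l)%N ^+ 2 * cof_proj G j (m + l) ^+ 2 <= t) &
    coordinate_bound sigma a C G j =
      (2 * (1 + C) * weight a m (cof_proj G j j) * (t + a ^+ m))%:E].
  have : (coordinate_bound sigma a C G j <= B%:E)%E.
    by apply: le_trans T_le; exact: (le_sume j coordinate_bound_ge0).
  rewrite /coordinate_bound gt_eqF ?cof_norm2_gt0//= mulr1.
  set k := 2 * _ * _; set s := (\sum_(_ <oo) _)%E.
  have k0 : 0 < k.
    rewrite mulr_gt0//; first by rewrite mulr_gt0// addr_gt0.
    by have := weight_ge1 a_gt0 m (cof_proj G j j); lra.
  have s0 : (0 <= s)%E by apply: nneseries_ge0 => l _ _;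
    rewrite lee_fin term_ge0.
  case sE : s s0 => [t| |]// t0.
    move=> _; exists t; split; [by rewrite -lee_fin| |by rewrite -EFinD -EFinM].
    by apply: (nneseries_leP _ (term_ge0 j)).1; rewrite -/s sE.
  by rewrite addye// mulry gtr0_sg// mul1e.
pose b j := 2 * (1 + C) * weight a m (cof_proj G j j) * (t j + a ^+ m).
have b0 j : 0 <= b j.
  have := weight_ge1 a_gt0 m (cof_proj G j j) => w1.
  apply: mulr_ge0; last by rewrite addr_ge0// ltW.
  by apply: mulr_ge0; have := C_gt0; lra.
rewrite (eq_bigr _ (fun j _ => cE j)) sumEFin -EFinD lee_fin -/b in TU_le.
have sb0 : 0 <= \sum_j b j by exact: sumr_ge0.
apply: (radius_le sigma_gt0 sigma_noninc) => x y Ex Ey Gxy.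
have B0 : 0 <= B by apply: le_trans TU_le; rewrite addr_ge0// mulr_ge0// ltW.
apply/l2norm_leP => // N.
(* The head contributes (sum of b)^2 and the tail 4 sigma_m^2; the cross term of this square is
   nonnegative. *)
apply: (@le_trans _ _ ((\sum_j b j + 2 * sigma m) ^+ 2)); last first.
  by rewrite ler_sqr ?nnegrE// addr_ge0// mulr_ge0// ltW.
apply: (@le_trans _ _ (\sum_(j < m + N) (y \- x) j ^+ 2)).
  rewrite addnC big_split_ord/= lerDl sumr_ge0// => j _; exact: sqr_ge0.
rewrite big_split_ord/=.
have h1 : \sum_(j < m) (y j - x j) ^+ 2 <= (\sum_j b j) ^+ 2.
  apply: le_trans (sum_sqr_le_sqr_sum b0); apply: ler_sum => j _.
  rewrite -real_normK ?num_real// ler_sqr ?nnegrE//.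
  exact: (coordinate_le sigma_gt0 a_gt0 a_lt1 sigma_le sigma_noninc D0 C_gt0
    (t0 j) Ex Ey Gxy Gq (Tt j)).
have h2 := @sum_sqr_le _ _ sigma_gt0 sigma_noninc (y \- x) m 4
  (ellipsoid_diff sigma_gt0 sigma_noninc Ex Ey) N.
apply: (le_trans (lerD h1 h2)); rewrite sqrrD exprMn.
by have : 0 <= (\sum_j b j) * (2 * sigma m) *+ 2;
  [rewrite mulrn_wge0// mulr_ge0// mulr_ge0// ltW|lra].
Qed.

End radius_bounds.

(** A kernel vector supported on the first m + 1 coordinates exists by rank. Once it is on the
    boundary of the ellipsoid, its norm is at least [sigma m], the smallest semi-axis involved
    (zero-based). *)
Lemma radius_ge_sigma (R : realType) (sigma : nat -> R) (m : nat)
    (G : 'I_m -> nat -> R) :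
  (forall j, 0 < sigma j) -> nonincreasing_seq sigma ->
  ((sigma m)%:E <= radius sigma G)%E.
Proof.
move=> s0 sN.
pose A : 'M[R]_(m.+1, m) := \matrix_(j, i) G i j.
have : kermx A != 0.
  rewrite kermx_eq0 /row_free; apply/negP => /eqP rA.
  by have := rank_leq_col A; rewrite rA ltnn.
move=> /rowV0Pn[v /sub_kermxP vA v0].
pose c := \sum_(j < m.+1) (v 0 j / sigma j) ^+ 2.
have c0 : 0 < c.
  rewrite lt_neqAle sumr_ge0 => [|j _]; last exact: sqr_ge0.
  rewrite andbT eq_sym psumr_neq0 => [|j _]; last exact: sqr_ge0.
  apply/hasP; have [j vj] : exists j, v 0 j != 0.
    apply/existsP; rewrite -negb_forall; apply: contra v0 => /forallP h.
    by apply/eqP/rowP => j; rewrite mxE; exact/eqP.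
  by exists j; rewrite ?mem_index_enum//= exprn_even_gt0//= mulf_neq0// invr_neq0// gt_eqF.
pose x (j : nat) : R := if (j < m.+1)%N then v 0 (inord j) / Num.sqrt c else 0.
have x1 : \sum_(j < m.+1) (x j / sigma j) ^+ 2 = 1.
  transitivity (\sum_(j < m.+1) (v 0 j / sigma j) ^+ 2 / c).
    apply: eq_bigr => j _.
    by rewrite /x ltn_ord inord_val mulrAC expr_div_n sqr_sqrtr ?ltW.
  by rewrite -mulr_suml divff ?gt_eqF.
have xsum (f : nat -> R -> R) N : (forall j, f j 0 = 0) -> (forall j r, 0 <= f j r) ->
    \sum_(j < N) f j (x j) <= \sum_(j < m.+1) f j (x j).
  move=> f0 fge0; apply: (@le_trans _ _ (\sum_(j < m.+1 + N) f j (x j))).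
    by rewrite addnC big_split_ord/= lerDl sumr_ge0.
  rewrite big_split_ord/= [X in _ + X]big1 ?addr0// => j _.
  by rewrite /x ltnNge leq_addr.
have Ex : ellipsoid sigma x.
  apply/ellipsoidP => // N; rewrite -x1.
  apply: (xsum (fun j r => (r / sigma j) ^+ 2)) => [j|j r]; last exact: sqr_ge0.
  by rewrite mul0r expr0n.
(* For finitely supported [z] the partial sums are eventually constant, so no component of the
   information is NaN. *)
have Gx0 i (z : nat -> R) : (forall j, (m < j)%N -> z j = 0) ->
    \sum_(j < m.+1) G i j * z j = 0 -> series (fun j => G i j * z j) @ \oo --> (0 : R).
  move=> zm z0; rewrite -(cvg_shiftn m.+1).
  rewrite (_ : [sequence _]_n = cst 0); first exact: cvg_cst.
  apply/funext => n; rewrite /series/= big_mkord addnC big_split_ord/= z0 add0r.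
  by rewrite big1// => j _; rewrite zm ?mulr0// ltn_addr.
have vAi i : \sum_(j < m.+1) G i j * x j = 0.
  have /matrixP/(_ 0 i) := vA; rewrite !mxE => h.
  transitivity ((\sum_j v 0 j * A j i) / Num.sqrt c); last by rewrite h mul0r.
  rewrite mulr_suml; apply: eq_bigr => j _.
  by rewrite mxE /x ltn_ord inord_val mulrCA mulrA.
have info0 z : (forall j, (m < j)%N -> z j = 0) ->
    (forall i, \sum_(j < m.+1) G i j * z j = 0) -> info G z = fun=> Some 0.
  move=> zm z0; apply/funext => i; rewrite /info/=.
  have h := Gx0 i z zm (z0 i); rewrite asboolT; last by apply/cvg_ex; exists 0.
  by congr Some; exact: cvg_lim h.
apply: (radius_ge s0 sN Ex).
  have xm j : (m < j)%N -> x j = 0 by move=> mj; rewrite /x ltnNge mj.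
  rewrite (info0 x)// (info0 (\- x))// => [j mj|i] /=;
    first by rewrite xm// oppr0.
  by under eq_bigr do rewrite /= mulrN; rewrite sumrN vAi oppr0.
move=> M hM; have M0 : 0 <= M.
  by rewrite -lee_fin; apply: le_trans hM; exact: Lnorm_ge0.
have := (l2norm_leP _ M0).1 hM m.+1;
  rewrite -(@ler_sqr _ (sigma m)) ?nnegrE ?(ltW (s0 _))//.
apply: le_trans; rewrite -[leLHS]mulr1 -x1 mulr_sumr; apply: ler_sum => j _.
rewrite expr_div_n mulrCA ler_piMr ?sqr_ge0// ler_pdivrMr ?exprn_gt0// mul1r.
by rewrite ler_sqr ?nnegrE ?(ltW (s0 _))//; apply: sN; rewrite -ltnS.
Qed.

(** * Expectation of the bound *)

Section measurable_matrix.
Context d (T : measurableType d) (R : realType).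

(** With [0^-1 = 0], this indicator is f / f. *)
Lemma measurable_nonzero (f : T -> R) : measurable_fun setT f ->
  measurable_fun setT (fun x => (f x != 0)%:R : R).
Proof.
move=> mf; rewrite (_ : (fun _ => _) = fun x => f x * (f x)^-1).
  by apply: measurable_funM => //; exact: measurable_invr.
by apply/funext => x; have [->|fx0] := eqVneq (f x) 0; rewrite ?mul0r ?divff.
Qed.

Lemma measurable_det k (F : 'I_k -> 'I_k -> T -> R) :
  (forall i j, measurable_fun setT (F i j)) ->
  measurable_fun setT (fun w => \det (\matrix_(i, j) F i j w)).
Proof.
move=> mF; rewrite /determinant; apply: measurable_sumr => s.
apply: measurable_funM => //.
under eq_fun do under eq_bigr do rewrite mxE.
by apply: measurable_prod => i _; exact: mF.
Qed.

(** The hypothesis spares column [j]: cofactors along it depend on the other columns only, whence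
    their independence of that column. *)
Lemma measurable_cofactor k (F : 'I_k -> 'I_k -> T -> R) (i j : 'I_k) :
  (forall i' j', j' != j -> measurable_fun setT (F i' j')) ->
  measurable_fun setT (fun w => cofactor (\matrix_(i, j) F i j w) i j).
Proof.
move=> mF; rewrite /cofactor; apply: measurable_funM => //.
rewrite (_ : (fun w => _) =
    fun w => \det (\matrix_(i', j') F (lift i i') (lift j j') w)).
  by apply: measurable_det => i' j'; apply: mF; rewrite eq_sym neq_lift.
by apply/funext => w; congr (\det _); apply/matrixP => i' j'; rewrite !mxE.
Qed.

End measurable_matrix.

(** * Normalized Gaussian combinations *)

Section normalized_combination.
Context d (T : measurableType d) (R : realType) (P : probability T R).
Context (I : eqType) (X : I -> {RV P >-> R}).
Hypothesis indepX : mutually_independent X.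
Hypothesis gaussX : forall k,
  distribution P (X k) = normal_prob 0 1 :> (set R -> \bar R).
Context (J : eqType) (e : J -> I) (K : seq I) (s : seq J).
Context (h : T -> R) (u : J -> T -> R).
Hypothesis esK : uniq (map e s ++ K).
Hypothesis mh : measurable_fun setT (h : generated X K -> R).
Hypothesis mu : forall k, measurable_fun setT (u k : generated X K -> R).
Hypothesis h0 : forall w, 0 <= h w.

Let N w := \sum_(k <- s) u k w ^+ 2.
Let S w := \sum_(k <- s) u k w / Num.sqrt (N w) * X (e k) w.

Let N0 w : 0 <= N w.
Proof. by apply: sumr_ge0 => k _; exact: sqr_ge0. Qed.

Let mN : measurable_fun setT (N : generated X K -> R).
Proof. by apply: measurable_sumr => k; exact: measurable_funX. Qed.

Let mc k : measurable_fun setT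
  ((fun w => u k w / Num.sqrt (N w)) : generated X K -> R).
Proof.
by apply: measurable_funM => //; apply: measurable_invr;
  exact: measurable_sqrtr.
Qed.

Lemma measurable_normalized_combination :
  measurable_fun setT (S : generated X (map e s ++ K) -> R).
Proof. exact: measurable_sum_generated. Qed.

(** The squared normalized coefficients sum to 1 where N is nonzero, so the time runs from 0 to 1
    there and [heat l 1 0] is the constant in front. Thus [S] behaves like a standard normal
    independent of [h]. *)
Lemma expectation_heat_normalized (l : R) : -1 < l ->
  (\int[P]_w (h w * (N w != 0)%:R * heat l 0 (S w))%:E =
   (Num.sqrt (1 + l))^-1%:E * \int[P]_w (h w * (N w != 0)%:R)%:E)%E.
Proof.
move=> l1.
have sum1 w : \sum_(k <- s) (u k w / Num.sqrt (N w)) ^+ 2 = (N w != 0)%:R.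
  under eq_bigr do rewrite expr_div_n sqr_sqrtr//.
  rewrite -mulr_suml -/(N w).
  by have [->|Nw] := eqVneq (N w) 0; rewrite ?mul0r ?divff.
rewrite (@expectation_heat _ _ _ P I X indepX gaussX J e l K s
  (fun w => h w * (N w != 0)%:R) (fun=> 0)
  (fun k w => u k w / Num.sqrt (N w)))//.
- rewrite -ge0_integralZl//.
  + apply: eq_integral => w _; rewrite -EFinM add0r sum1 heat_y0; congr EFin.
    by case: eqP => _; rewrite ?mulr0 ?mulr1 ?mul0r// mulrC.
  + apply/measurable_EFinP;
      apply: (@measurable_fun_generatedT _ _ _ P _ X _ _ K).
    by apply: measurable_funM => //; exact: measurable_nonzero.
  + by move=> w _; rewrite lee_fin mulr_ge0.
- by apply: measurable_funM => //; exact: measurable_nonzero.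
- by move=> w; rewrite mulr_ge0.
- by move=> w; rewrite add0r sum1; case: eqP.
Qed.

End normalized_combination.

(** On this event the normalized combination vanishes and [heat l 0] equals 1 there, so the
    probability is at most (1 + l)^(-1/2) for every l >= 0. *)
Lemma combination_neq0 d (T : measurableType d) (R : realType)
    (P : probability T R) (I J : eqType) (X : I -> {RV P >-> R}) (e : J -> I)
    (K : seq I) (s : seq J) (u : J -> T -> R) :
  mutually_independent X ->
  (forall k, distribution P (X k) = normal_prob 0 1 :> (set R -> \bar R)) ->
  uniq (map e s ++ K) ->
  (forall k, measurable_fun setT (u k : generated X K -> R)) ->
  P.-negligible [set w | \sum_(k <- s) u k w * X (e k) w = 0 /\
                         \sum_(k <- s) u k w ^+ 2 != 0].
Proof.
move=> indepX gaussX esK mu.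
set N := fun w => \sum_(k <- s) u k w ^+ 2.
set E := [set w | _].
have muT k : measurable_fun setT (u k).
  exact: (@measurable_fun_generatedT _ _ _ P _ X _ _ K).
have mN : measurable_fun setT N.
  by apply: measurable_sumr => k; exact: measurable_funX.
have mS : measurable_fun setT (fun w => \sum_(k <- s) u k w * X (e k) w).
  by apply: measurable_sumr => k; exact: measurable_funM.
have mE : measurable E.
  rewrite (_ : E = (fun w => \sum_(k <- s) u k w * X (e k) w) @^-1` [set 0] `&`
      N @^-1` ~` [set 0]).
    apply: measurableI; rewrite -[X in measurable X]setTI;
      [exact: mS|apply: mN => //].
    exact: measurableC.
  by apply/seteqP; split => w /= [? /eqP].
have PE l : 0 <= l -> (P E <= (Num.sqrt (1 + l))^-1%:E)%E.
  move=> l0; rewrite -[E]setIT -integral_indic//.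
  have l1 : -1 < l by lra.
  have cE := expectation_heat_normalized indepX gaussX esK
    (measurable_cst (1 : R)) mu (fun=> ler01) l1.
  apply: (@le_trans _ _ ((Num.sqrt (1 + l))^-1%:E *
      \int[P]_w (1 * (N w != 0)%:R)%:E)%E).
    rewrite -cE.
    apply: ge0_le_integral => //.
    - exact/measurable_EFinP/measurable_indic.
    - apply/measurable_EFinP; apply: measurable_funM.
        by apply: measurable_funM => //; exact: measurable_nonzero.
      apply: measurable_heat => //.
      apply: measurable_fun_generatedT;
        exact: measurable_normalized_combination.
    - move=> w _; rewrite lee_fin indicE; have [wE|_] := boolP (w \in E);
        last first.
        by rewrite mulr_ge0 ?heat_ge0// mulr_ge0.
      move: wE; rewrite inE => -[S0 N0]; rewrite /cst -/(N w) N0 !mul1r.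
      under eq_bigr do rewrite mulrAC.
      by rewrite -mulr_suml S0 mul0r heat_v0 expr0n/= mulr0 mul0r expR0.
  rewrite -[leRHS]mule1; apply: lee_wpmul2l;
    first by rewrite lee_fin invr_ge0 sqrtr_ge0.
  apply: (@le_trans _ _ (\int[P]_w 1%:E)%E); last first.
    by rewrite integral_cst// mul1e; exact: probability_le1.
  apply: ge0_le_integral => //.
  - by apply/measurable_EFinP; apply: measurable_funM => //;
      exact: measurable_nonzero.
  - by move=> w _; rewrite lee_fin mul1r; case: eqP.
suff PE0 : P E = 0%E by exact/negligibleP.
apply/eqP; rewrite eq_le measure_ge0 andbT.
have fP : P E \is a fin_num by exact: fin_num_measure.
rewrite -(fineK fP) lee_fin leNgt; apply/negP => p0.
set p := fine _ in p0.
(* With l = p^-2 the bound is strictly below (p^-2)^(-1/2) = p, a contradiction. *)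
have := PE (p ^- 2); rewrite -(fineK fP) lee_fin -/p => /(_ _).
rewrite invr_ge0 sqr_ge0 => /(_ isT); rewrite leNgt => /negP; apply.
rewrite -[ltRHS]invrK ltf_pV2 ?posrE ?invr_gt0 ?sqrtr_gt0 ?addr_gt0 ?invr_gt0 ?exprn_gt0//.
rewrite -[ltLHS]ger0_norm ?invr_ge0 ?(ltW p0)// -sqrtr_sqr ltr_sqrt ?exprVn ?ltrDr//.
by rewrite addr_gt0 ?invr_gt0 ?exprn_gt0.
Qed.

(* A negative parameter in [heat] replaces second moments. *)
Lemma sqr_le_heat (R : realType) (y : R) : y ^+ 2 <= 4 * heat (- 2^-1) 0 y.
Proof.
rewrite heat_v0; have := expR_ge1Dx (- - 2^-1 * y ^+ 2 / 2).
by have := sqr_ge0 y; lra.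
Qed.

(** The factor of [expectation_heat_normalized] at l = -1/2; with the 4 of [sqr_le_heat] it produces
    the constant 6 below. *)
Lemma inv_sqrt_half_le (R : realType) : (Num.sqrt (1 - 2^-1 : R))^-1 <= 3 / 2.
Proof.
have h : (2 / 3 : R) <= Num.sqrt (1 - 2^-1).
  rewrite -[leLHS]ger0_norm ?divr_ge0// -sqrtr_sqr ler_wsqrtr//.
  by rewrite expr2; lra.
rewrite -[leRHS]invrK lef_pV2 ?posrE ?invr_gt0 ?divr_gt0//;
  first by rewrite invf_div.
by apply: lt_le_trans h; rewrite divr_gt0.
Qed.

Lemma measurable_weight d (T : measurableType d) (R : realType) (a : R) m
    (f : T -> R) :
  measurable_fun setT f -> measurable_fun setT (fun w => weight a m (f w)).
Proof.
move=> mf; apply: measurable_funD => //; apply: measurable_sumr => i.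
by apply: measurable_funM => //; exact: measurable_heat.
Qed.

(** * The Gaussian matrix: nonsingularity and moments *)

Section gaussian_matrix.
Context d (T : measurableType d) (R : realType) (P : probability T R) (n : nat).
Context (G : 'I_n -> nat -> {RV P >-> R}) (a : R).
Hypothesis a_gt0 : 0 < a.
Hypothesis hG : gaussian_matrix G.

Let X (ij : 'I_n * nat) := G ij.1 ij.2.
Let gaussX k : distribution P (X k) = normal_prob 0 1 :> (set R -> \bar R).
Proof. exact: hG.1. Qed.
Let indepX : mutually_independent X := hG.2.

(** Induction along the expansion by the first column, whose cofactors are independent of it: they
    vanish together only if a smaller minor does, and otherwise [combination_neq0] applies.
    Arbitrary injections [r] and [c] make the statement stable under deleting a row and a column. *)
Lemma negligible_det_gaussian_eq0 k (r : 'I_k -> 'I_n) (c : 'I_k -> nat) :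
  injective r -> injective c ->
  P.-negligible [set w | \det (\matrix_(i, j) G (r i) (c j) w) = 0].
Proof.
elim: k r c => [|k IH] r c rI cI.
  rewrite (_ : [set w | _] = set0); first exact: negligible_set0.
  apply/seteqP; split => // w /=.
  by rewrite det_mx00 => /eqP; rewrite oner_eq0.
pose e i := (r i, c ord0).
pose K := [seq (r i, c (lift ord0 j)) | i <- enum 'I_k.+1, j <- enum 'I_k].
pose u i w := cofactor (\matrix_(i, j) G (r i) (c j) w) i ord0.
have eK : uniq (map e (enum 'I_k.+1) ++ K).
  rewrite cat_uniq map_inj_uniq ?enum_uniq => [|i j [/rI]//].
  rewrite allpairs_uniq ?enum_uniq//= => [|[i j] [i' j'] _ _ [/rI -> /cI /lift_inj ->]//].
  rewrite andbT; apply/hasPn => _ /allpairsP[[i j] /= [_ _ ->]].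
  by apply/mapP => -[i' _ [_ /cI /eqP]]; rewrite eq_sym (negbTE (neq_lift _ _)).
have mu i : measurable_fun setT (u i : generated X K -> R).
  apply: (@measurable_cofactor _ (generated X K) R k.+1
    (fun i j => (G (r i) (c j) : generated X K -> R))) => i' j' j0.
  have : (r i', c j') \in K.
    case: (unliftP ord0 j') j0 => [j'' ->|->] // _.
    by apply: (allpairs_f (fun i j => (r i, c (lift ord0 j))));
      rewrite mem_enum.
  exact: (@measurable_fun_generated _ _ _ P _ X).
have detE w : \det (\matrix_(i, j) G (r i) (c j) w) =
    \sum_(i <- enum 'I_k.+1) u i w * X (e i) w.
  rewrite (expand_det_col _ ord0) big_enum/=; apply: eq_bigr => i _.
  by rewrite mxE mulrC.
pose minor := fun w => \det (\matrix_(i, j) G (r (lift ord0 i)) (c (lift ord0 j)) w).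
have minorE w : u ord0 w = minor w.
  rewrite /u /cofactor expr0 mul1r; congr (\det _).
  by apply/matrixP => i j; rewrite !mxE.
have n1 : P.-negligible [set w | minor w = 0].
  by apply: (IH (r \o lift ord0) (c \o lift ord0)) => i j;
    [move=> /rI /lift_inj|move=> /cI /lift_inj].
have n2 := combination_neq0 indepX gaussX eK mu.
apply: (negligibleS _ (negligibleU n1 n2)) => w /=; rewrite detE => S0.
have [N0|N0] := eqVneq (\sum_(k <- enum 'I_k.+1) u k w ^+ 2) 0; [left|by right].
rewrite -minorE; apply/eqP; rewrite -sqrf_eq0; apply/eqP/le_anti.
rewrite sqr_ge0 andbT -N0 big_enum/= (bigD1 ord0)//= lerDl.
by apply: sumr_ge0 => i _; exact: sqr_ge0.
Qed.

Let Gw (w : T) : 'I_n -> nat -> R := fun i j => G i j w.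

Let col (l : nat) : seq ('I_n * nat) := map (fun i => (i, l)) (index_enum 'I_n).
Let others (j : 'I_n) : seq ('I_n * nat) :=
  [seq (i, val j') | i <- enum 'I_n, j' <- [seq j' <- enum 'I_n | j' != j]].

Let mem_others j i l : (i, l) \in others j -> (l < n)%N /\ l <> j.
Proof.
case/allpairsP => -[i' j'] /= [_ + [_ ->]]; rewrite mem_filter => /andP[j'j _].
by split; [exact: ltn_ord|move=> /val_inj jj; rewrite jj eqxx in j'j].
Qed.

Let col_uniq l : uniq (col l).
Proof. by rewrite map_inj_uniq => [|i i' []//]; exact: index_enum_uniq. Qed.

Let others_uniq (j : 'I_n) : uniq (others j).
Proof.
apply: allpairs_uniq; [exact: enum_uniq|exact/filter_uniq/enum_uniq|].
by move=> [i1 j1] [i2 j2] _ _ /= [-> /val_inj ->].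
Qed.

Let col_others_uniq (j : 'I_n) : uniq (col j ++ others j).
Proof.
rewrite cat_uniq col_uniq others_uniq andbT/=; apply/hasPn => -[i l] h.
by apply/mapP => -[i' _ [_ lj]]; have [_] := mem_others h; rewrite lj.
Qed.

Let col_col_others_uniq (j : 'I_n) l :
  (n <= l)%N -> uniq (col l ++ (col j ++ others j)).
Proof.
move=> nl; rewrite cat_uniq col_uniq col_others_uniq andbT/=;
  apply/hasPn => -[i l'] h.
apply/mapP => -[i' _ [_ ll]]; move: h;
  rewrite mem_cat => /orP[/mapP[i1 _ [_]]|].
  by rewrite ll => lj; move: nl; rewrite lj leqNgt ltn_ord.
by case/mem_others; rewrite ll ltnNge nl.
Qed.

Let measurable_cof_others (j i : 'I_n) :
  measurable_fun setT ((fun w => cof (Gw w) j i) : generated X (others j) -> R).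
Proof.
apply: (@measurable_cofactor _ (generated X (others j)) R n
  (fun i j => (G i j : generated X (others j) -> R))) => i' j' j0.
have : (i', val j') \in others j.
  apply/allpairsP; exists (i', j'); split => //; first exact: mem_enum.
  by rewrite mem_filter; apply/andP; split; [exact: j0|exact: mem_enum].
exact: (@measurable_fun_generated _ _ _ P _ X).
Qed.

Let measurable_cof_col (j i : 'I_n) :
  measurable_fun setT
    ((fun w => cof (Gw w) j i) : generated X (col j ++ others j) -> R).
Proof.
have sub : {subset others j <= col j ++ others j}.
  by move=> k; rewrite mem_cat orbC => ->.
exact: (@measurable_fun_generatedW _ _ _ P _ X _ _ _ _ _ sub
  (@measurable_cof_others j i)).
Qed.

Let nondeg (j : 'I_n) (w : T) : R := (cof_norm2 (Gw w) j != 0)%:R.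
Let proj (j : 'I_n) (l : nat) (w : T) : R := cof_proj (Gw w) j l.
Let W (j : 'I_n) (w : T) : R := weight a n (proj j j w).

Let nondeg_ge0 j w : 0 <= nondeg j w. Proof. by rewrite /nondeg; case: eqP. Qed.
Let nondeg_le1 j w : nondeg j w <= 1. Proof. by rewrite /nondeg; case: eqP. Qed.
Let W_ge0 j w : 0 <= W j w.
Proof. by have := weight_ge1 a_gt0 n (proj j j w); rewrite -/(W j w); lra. Qed.

Let measurable_proj (j : 'I_n) l (K : seq ('I_n * nat)) :
  (forall i,
    measurable_fun setT ((fun w => cof (Gw w) j i) : generated X K -> R)) ->
  measurable_fun setT (proj j l : generated X (col l ++ K) -> R).
Proof.
move=> mc.
exact: (@measurable_normalized_combination _ _ _ P _ X _ (fun i => (i, l)) K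
  (index_enum 'I_n) (fun i w => cof (Gw w) j i) mc).
Qed.

Let measurable_W (j : 'I_n) :
  measurable_fun setT (W j : generated X (col j ++ others j) -> R).
Proof.
apply: measurable_weight; apply: measurable_proj => i.
exact: measurable_cof_others.
Qed.

Let measurable_projT j l : measurable_fun setT (proj j l).
Proof.
apply: measurable_fun_generatedT (@measurable_proj j l (others j) _) => i.
exact: measurable_cof_others.
Qed.

Let measurable_WT j : measurable_fun setT (W j).
Proof. exact: measurable_fun_generatedT (@measurable_W j). Qed.

Let measurable_nondegT j : measurable_fun setT (nondeg j).
Proof.
apply: measurable_nonzero; apply: measurable_sumr => i; apply: measurable_funX.
exact: measurable_fun_generatedT (@measurable_cof_others j i).
Qed.

Let integral_heat_proj (j : 'I_n) l (K : seq ('I_n * nat)) (h : T -> R)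
    (lam : R) :
  -1 < lam -> uniq (col l ++ K) ->
  (forall i,
    measurable_fun setT ((fun w => cof (Gw w) j i) : generated X K -> R)) ->
  measurable_fun setT (h : generated X K -> R) -> (forall w, 0 <= h w) ->
  (\int[P]_w (h w * nondeg j w * heat lam 0 (proj j l w))%:E =
   (Num.sqrt (1 + lam))^-1%:E * \int[P]_w (h w * nondeg j w)%:E)%E.
Proof.
move=> lam1 uK mc mh h0.
exact: (@expectation_heat_normalized _ _ _ P _ X indepX gaussX _ (fun i => (i, l)) K
  (index_enum 'I_n) h (fun i w => cof (Gw w) j i) uK mh mc h0 lam lam1).
Qed.

Let integral_le1 (f : T -> R) : measurable_fun setT f ->
  (forall w, 0 <= f w) -> (forall w, f w <= 1) -> (\int[P]_w (f w)%:E <= 1)%E.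
Proof.
move=> mf f0 f1; apply: (@le_trans _ _ (\int[P]_w 1%:E)%E); last first.
  by rewrite integral_cst// mul1e; exact: probability_le1.
apply: ge0_le_integral => // [w _||w _]; rewrite ?lee_fin//.
exact/measurable_EFinP.
Qed.

(** The normalized cofactors are independent of column [j], so the [heat] factor of the i-th summand
    has expectation at most (1 + a^(-2i))^(-1/2) <= a^i. This cancels a^-i, and each summand
    contributes at most 2 / a. *)
Lemma integral_weight (j : 'I_n) :
  (\int[P]_w (nondeg j w * W j w)%:E <= (1 + n%:R * (2 / a))%:E)%E.
Proof.
pose k (i : 'I_n) : R := 2 / a * (a ^+ i)^-1.
have k0 i : 0 <= k i by rewrite mulr_ge0 ?divr_ge0 ?invr_ge0 ?exprn_ge0// ltW.
pose f (i : 'I_n) w := 1 * nondeg j w * heat ((a ^+ i) ^- 2) 0 (proj j j w).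
have f0 i w : 0 <= f i w by rewrite mulr_ge0 ?heat_ge0// mul1r.
have mf i : measurable_fun setT (f i).
  apply: measurable_funM; first exact: measurable_funM.
  exact: measurable_heat.
have mkf i : measurable_fun setT (fun w => (k i)%:E * (f i w)%:E)%E.
  by apply/measurable_EFinP; exact: measurable_funM.
have -> : (\int[P]_w (nondeg j w * W j w)%:E =
    \int[P]_w ((nondeg j w)%:E + \sum_i (k i)%:E * (f i w)%:E))%E.
  apply: eq_integral => w _;
    rewrite /W /weight mulrDr mulr1 mulr_sumr EFinD -sumEFin.
  congr (_ + _)%E; apply: eq_bigr => i _; rewrite -EFinM; congr EFin.
  by rewrite /f /k; ring.
rewrite ge0_integralD//=.
- rewrite EFinD; apply: leeD; first exact: integral_le1.
  rewrite ge0_integral_sum//=; last first.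
    by move=> i w _; rewrite mule_ge0 ?lee_fin.
  apply: (@le_trans _ _ (\sum_(i < n) (2 / a)%:E)%E); last first.
    by rewrite sumEFin lee_fin sumr_const card_ord -[leLHS]mulr_natl.
  apply: lee_sum => i _; rewrite ge0_integralZl//=; last 3 first.
  + exact/measurable_EFinP.
  + by move=> w _; rewrite lee_fin.
  + by rewrite lee_fin.
  have ai0 : 0 < a ^+ i by rewrite exprn_gt0.
  have lam0 : 0 < (a ^+ i) ^- 2 by rewrite invr_gt0 exprn_gt0.
  rewrite (@integral_heat_proj j j (others j) (fun=> 1))//; [|lra].
  apply: (@le_trans _ _ ((k i)%:E * (a ^+ i)%:E)%E); last first.
    by rewrite -EFinM lee_fin /k divfK ?gt_eqF.
  apply: lee_wpmul2l; first by rewrite lee_fin.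
  rewrite -[leRHS]mule1; apply: lee_pmul.
  + by rewrite lee_fin invr_ge0.
  + by apply: integral_ge0 => w _; rewrite lee_fin mul1r.
  + rewrite lee_fin -[leRHS]invrK lef_pV2 ?posrE ?invr_gt0// ?sqrtr_gt0 ?addr_gt0//.
    rewrite -[leLHS]ger0_norm ?invr_ge0 ?(ltW ai0)// -sqrtr_sqr ler_wsqrtr// exprVn; lra.
  + by under eq_integral do rewrite mul1r; exact: integral_le1.
- by move=> w _; rewrite lee_fin.
- exact/measurable_EFinP.
- by move=> w _; apply: sume_ge0 => i _; rewrite mule_ge0 ?lee_fin.
- exact: emeasurable_sum.
Qed.

(** Column [l] lies outside the square block, hence is independent of the weight as well as of the
    cofactors; the weight takes the place of [h]. *)
Lemma integral_weight_proj (j : 'I_n) l : (n <= l)%N ->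
  (\int[P]_w (nondeg j w * W j w * proj j l w ^+ 2)%:E <=
   (6 * (1 + n%:R * (2 / a)))%:E)%E.
Proof.
move=> nl; pose f w := W j w * nondeg j w * heat (- 2^-1) 0 (proj j l w).
have f0 w : 0 <= f w by rewrite mulr_ge0 ?heat_ge0// mulr_ge0.
have mf : measurable_fun setT f.
  by apply: measurable_funM; [exact: measurable_funM|exact: measurable_heat].
apply: (@le_trans _ _ (\int[P]_w (4%:E * (f w)%:E))%E).
  apply: ge0_le_integral => //.
  - by move=> w _; rewrite lee_fin mulr_ge0 ?sqr_ge0// mulr_ge0.
  - apply/measurable_EFinP; apply: measurable_funM;
      first exact: measurable_funM.
    exact: measurable_funX.
  - by apply/measurable_EFinP; exact: measurable_funM.
  - move=> w _; rewrite -EFinM lee_fin [leRHS](_ : _ =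
      nondeg j w * W j w * (4 * heat (- 2^-1) 0 (proj j l w)));
        last by rewrite /f; ring.
    by apply: ler_wpM2l; [rewrite mulr_ge0|exact: sqr_le_heat].
rewrite ge0_integralZl//=; last 2 first.
- exact/measurable_EFinP.
- by move=> w _; rewrite lee_fin.
rewrite (@integral_heat_proj j l (col j ++ others j) (W j))//; last 2 first.
- by lra.
- exact: col_col_others_uniq.
have -> : (6 * (1 + n%:R * (2 / a)))%:E =
    (4%:E * ((3 / 2)%:E * (1 + n%:R * (2 / a))%:E))%E.
  by rewrite -!EFinM; congr EFin; field; rewrite gt_eqF.
apply: lee_wpmul2l => //; apply: lee_pmul.
- by rewrite lee_fin invr_ge0.
- by apply: integral_ge0 => w _; rewrite lee_fin mulr_ge0.
- by rewrite lee_fin inv_sqrt_half_le.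
- by under eq_integral do rewrite mulrC; exact: integral_weight.
Qed.

Lemma integral_sqr i l : (\int[P]_w (G i l w ^+ 2)%:E <= 6%:E)%E.
Proof.
pose f w : R := heat (- 2^-1) 0 (G i l w).
have mG : measurable_fun setT (G i l) by exact: measurable_funP.
have mf : measurable_fun setT f by exact: measurable_heat.
apply: (@le_trans _ _ (\int[P]_w (4%:E * (f w)%:E))%E).
  apply: ge0_le_integral => //.
  - by move=> w _; rewrite lee_fin sqr_ge0.
  - by apply/measurable_EFinP; exact: measurable_funX.
  - by apply/measurable_EFinP; exact: measurable_funM.
  - by move=> w _; rewrite -EFinM lee_fin sqr_le_heat.
rewrite ge0_integralZl//=; last 2 first.
- exact/measurable_EFinP.
- by move=> w _; rewrite lee_fin heat_ge0.
have -> : 6%:E = (4%:E * (3 / 2)%:E)%E :> \bar R by rewrite -EFinM; congr EFin;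
  field.
apply: lee_wpmul2l => //.
have half : -1 < - 2^-1 :> R by lra.
have c1 (w : T) : 0 + \sum_(k <- [:: tt]) (1 : R) ^+ 2 <= 1.
  by rewrite big_seq1 add0r expr1n.
(* A combination of a single variable with coefficient 1, indexed by [unit], and an empty list of
   frozen variables. *)
have := @expectation_heat _ _ _ P _ X indepX gaussX unit (fun=> (i, l)) (- 2^-1) [::]
  [:: tt] (fun=> 1) (fun=> 0) (fun _ _ => 1) half isT (measurable_cst _) (measurable_cst _)
  (fun=> measurable_cst _) (fun=> ler01) (fun=> lexx 0) c1.
under eq_integral do rewrite big_seq1 !mul1r.
under [X in _ = X -> _]eq_integral do
  rewrite big_seq1 mul1r add0r expr1n heat_y0 mulr1.
move=> ->.
by rewrite integral_cst//= probability_setT mule1 lee_fin inv_sqrt_half_le.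
Qed.

(** * Summation of the expected bounds *)

Section bound.
Context (sigma : nat -> R) (C : R).
Hypotheses (a_lt1 : a < 1) (C_gt0 : 0 < C) (n_gt0 : (0 < n)%N).
Hypothesis sigma_gt0 : forall j, 0 < sigma j.
Hypothesis sigma_le : forall j, sigma j <= C * a ^+ j.+1.

Let D := 6 * C ^+ 2 / (1 - a).
Let D_ge0 : 0 <= D.
Proof. by apply: divr_ge0;
  [exact: mulr_ge0 (sqr_ge0 C)|rewrite subr_ge0 ltW]. Qed.
Let wn := 1 + n%:R * (2 / a).
Let wn_ge1 : 1 <= wn.
Proof. by rewrite lerDl mulr_ge0// divr_ge0// ltW. Qed.
Let an_gt0 : 0 < a ^+ n. Proof. by rewrite exprn_gt0. Qed.

Let al_ge0 l : 0 <= a ^+ l. Proof. by rewrite exprn_ge0// ltW. Qed.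
Let al_le1 l : a ^+ l <= 1. Proof. by rewrite exprn_ile1// ltW. Qed.

(** The two powers are kept apart: one gives a convergent geometric series, while the other is
    dropped for the rows and compensates a^-n in the tail. *)
Let sigma2_le j : sigma j ^+ 2 <= C ^+ 2 * a ^+ j * a ^+ j.
Proof.
rewrite -mulrA -!expr2 -exprMn ler_sqr ?nnegrE ?mulr_ge0 ?exprn_ge0
  ?(ltW C_gt0) ?(ltW a_gt0) ?(ltW (sigma_gt0 _))//.
apply: le_trans (sigma_le j) _; rewrite ler_pM2l// exprS ler_piMl ?exprn_ge0//;
  exact: ltW.
Qed.

Let row_term (i : 'I_n) l w := a ^+ n * (sigma l * G i l w) ^+ 2.
Let row_term_ge0 i l w : 0 <= row_term i l w.
Proof. by rewrite mulr_ge0 ?sqr_ge0// ltW. Qed.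
Let measurable_row_term i l : measurable_fun setT (row_term i l).
Proof.
by apply: measurable_funM => //; apply: measurable_funX; exact: measurable_funM.
Qed.

Let integral_row i :
  (\int[P]_w \sum_(l <oo) (row_term i l w)%:E <= (a ^+ n * D)%:E)%E.
Proof.
rewrite integral_nneseries//; last 2 first.
- by move=> l; exact/measurable_EFinP.
- by move=> l w _; rewrite lee_fin.
apply: (@le_trans _ _ (\sum_(l <oo) (a ^+ n * sigma l ^+ 2 * 6)%:E)%E).
  apply: lee_nneseries => [l _ _|l _].
    by apply: integral_ge0 => w _; rewrite lee_fin.
  under eq_integral do rewrite /row_term exprMn mulrA EFinM.
  rewrite ge0_integralZl//; last 3 first.
  - by apply/measurable_EFinP; apply: measurable_funX; exact: measurable_funP.
  - by move=> w _; rewrite lee_fin sqr_ge0.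
  - by rewrite lee_fin mulr_ge0 ?sqr_ge0// ltW.
  rewrite [leRHS]EFinM; apply: lee_wpmul2l; last exact: integral_sqr.
  by rewrite lee_fin mulr_ge0 ?sqr_ge0// ltW.
rewrite /D mulrA; apply: nneseries_geometric_le (ltW a_gt0) a_lt1 _ _ _ => [|l|l].
- by rewrite mulr_ge0 ?mulr_ge0 ?sqr_ge0// ltW.
- by rewrite mulr_ge0 ?mulr_ge0 ?sqr_ge0// ltW.
have -> : a ^+ n * (6 * C ^+ 2) * a ^+ l = a ^+ n * (C ^+ 2 * a ^+ l) * 6 by ring.
rewrite ler_wpM2r// ler_wpM2l ?(ltW an_gt0)//.
apply: le_trans (sigma2_le l) _.
by rewrite ler_piMr ?al_le1//; exact: mulr_ge0 (sqr_ge0 C) (al_ge0 l).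
Qed.

Let tail_term (j : 'I_n) l w :=
  a ^- n * sigma (n + l)%N ^+ 2 * proj j (n + l) w ^+ 2.
Let tail_term_ge0 j l w : 0 <= tail_term j l w.
Proof.
by apply: mulr_ge0 (sqr_ge0 _); apply: mulr_ge0 (sqr_ge0 _);
  rewrite invr_ge0 ltW.
Qed.
Let measurable_tail_term j l : measurable_fun setT (tail_term j l).
Proof.
by apply: measurable_funM => //; apply: measurable_funX;
  exact: measurable_projT.
Qed.

Let measurable_tail j :
  measurable_fun setT (fun w => \sum_(l <oo) (tail_term j l w)%:E)%E.
Proof.
apply: (@ge0_emeasurable_sum _ _ _ setT
  (fun l w => (tail_term j l w)%:E) xpredT) => [l w _ _|l _].
  by rewrite lee_fin.
exact/measurable_EFinP.
Qed.

Let measurable_row i :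
  measurable_fun setT (fun w => \sum_(l <oo) (row_term i l w)%:E)%E.
Proof.
apply: (@ge0_emeasurable_sum _ _ _ setT
  (fun l w => (row_term i l w)%:E) xpredT) => [l w _ _|l _].
  by rewrite lee_fin.
exact/measurable_EFinP.
Qed.

Let nondegW_ge0 j w : 0 <= nondeg j w * W j w.
Proof. exact: mulr_ge0. Qed.

(** Termwise, [integral_weight_proj] and the decay of sigma give a geometric series of total at most
    a^n wn D; the summand a^n adds a^n wn by [integral_weight]. *)
Let integral_tail j :
  (\int[P]_w ((nondeg j w * W j w)%:E *
      (\sum_(l <oo) (tail_term j l w)%:E + (a ^+ n)%:E)) <=
   (a ^+ n * wn * (D + 1))%:E)%E.
Proof.
have mNW : measurable_fun setT (fun w => nondeg j w * W j w) by exact: measurable_funM.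
have tail0 w : (0 <= \sum_(l <oo) (tail_term j l w)%:E)%E.
  by apply: nneseries_ge0 => l _ _; rewrite lee_fin.
under eq_integral.
  move=> w _; rewrite ge0_muleDr ?lee_fin ?(ltW an_gt0)//.
  rewrite -nneseriesZl ?lee_fin//; last by move=> l _; rewrite lee_fin.
  over.
have mt l : measurable_fun setT (fun w => (nondeg j w * W j w)%:E * (tail_term j l w)%:E)%E.
  by apply/measurable_EFinP; exact: measurable_funM.
rewrite ge0_integralD//=.
- rewrite mulrDr mulr1 [leRHS]EFinD; apply: leeD; last first.
    under eq_integral do rewrite muleC.
    rewrite ge0_integralZl ?lee_fin ?(ltW an_gt0)//.
    + by rewrite EFinM; apply: lee_wpmul2l; rewrite ?lee_fin ?(ltW an_gt0)//;
        exact: integral_weight.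
    + exact/measurable_EFinP.
    + by move=> w _; rewrite lee_fin.
  rewrite integral_nneseries//; last first.
    by move=> l w _; rewrite mule_ge0 ?lee_fin.
  apply: (@le_trans _ _ (\sum_(l <oo) (a ^- n * sigma (n + l)%N ^+ 2 * (6 * wn))%:E)%E).
    apply: lee_nneseries => [l _ _|l _].
      by apply: integral_ge0 => w _; rewrite mule_ge0 ?lee_fin.
    under eq_integral do rewrite -EFinM /tail_term mulrCA EFinM.
    rewrite ge0_integralZl//; last 3 first.
    + apply/measurable_EFinP; apply: measurable_funM => //;
        apply: measurable_funX.
      exact: measurable_projT.
    + by move=> w _; rewrite lee_fin mulr_ge0 ?sqr_ge0.
    + by rewrite lee_fin mulr_ge0 ?sqr_ge0// invr_ge0 ltW.
    rewrite [leRHS]EFinM; apply: lee_wpmul2l.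
      by rewrite lee_fin mulr_ge0 ?sqr_ge0// invr_ge0 ltW.
    by apply: integral_weight_proj; exact: leq_addr.
  have -> : a ^+ n * wn * D = a ^+ n * wn * (6 * C ^+ 2) / (1 - a) by rewrite /D !mulrA.
  have wn0 : 0 <= wn by apply: le_trans wn_ge1.
  apply: nneseries_geometric_le (ltW a_gt0) a_lt1 _ _ _ => [|l|l].
  + by apply: mulr_ge0;
      [exact: mulr_ge0 (ltW an_gt0) wn0|rewrite mulr_ge0 ?sqr_ge0].
  + apply: mulr_ge0; last exact: mulr_ge0.
    by apply: mulr_ge0 (sqr_ge0 _); rewrite invr_ge0 ltW.
  have -> : a ^+ n * wn * (6 * C ^+ 2) * a ^+ l =
      a ^- n * (C ^+ 2 * a ^+ (n + l) * a ^+ n) * (6 * wn).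
    by rewrite exprD; field; rewrite gt_eqF.
  rewrite ler_wpM2r ?mulr_ge0// ler_pM2l ?invr_gt0//.
  apply: le_trans (sigma2_le _) _.
  apply: ler_wpM2l; first exact: mulr_ge0 (sqr_ge0 C) (al_ge0 _).
  by rewrite exprD ler_piMr.
- by move=> w _; apply: nneseries_ge0 => l _ _; rewrite mule_ge0 ?lee_fin.
- apply: (@ge0_emeasurable_sum _ _ _ setT (fun l w =>
      (nondeg j w * W j w)%:E * (tail_term j l w)%:E)%E xpredT)
    => [l w _ _|l _//].
  by rewrite mule_ge0 ?lee_fin.
- by move=> w _; rewrite mule_ge0 ?lee_fin// ltW.
- by apply/measurable_EFinP; exact: measurable_funM.
Qed.

Let coordinate_boundE j w : coordinate_bound sigma a C (Gw w) j =
  ((2 * (1 + C))%:E * ((nondeg j w * W j w)%:E *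
    (\sum_(l <oo) (tail_term j l w)%:E + (a ^+ n)%:E)))%E.
Proof. by rewrite /coordinate_bound muleA -EFinM mulrA. Qed.

Let measurable_coordinate j :
  measurable_fun setT (fun w => coordinate_bound sigma a C (Gw w) j).
Proof.
under eq_fun do rewrite coordinate_boundE.
apply: emeasurable_funM => //; apply: emeasurable_funM.
  by apply/measurable_EFinP; exact: measurable_funM.
by apply: emeasurable_funD.
Qed.

Let row_sum_ge0 i w : (0 <= \sum_(l <oo) (row_term i l w)%:E)%E.
Proof. by apply: nneseries_ge0 => l _ _; rewrite lee_fin. Qed.

Let coordinate_ge0 j w : (0 <= coordinate_bound sigma a C (Gw w) j)%E.
Proof. exact: coordinate_bound_ge0. Qed.

Lemma radius_bound_ge0 w : (0 <= radius_bound sigma a C (Gw w))%E.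
Proof.
apply: adde_ge0; last by rewrite lee_fin mulr_ge0// ltW.
by apply: adde_ge0; apply: sume_ge0 => i _;
  [exact: row_sum_ge0|exact: coordinate_ge0].
Qed.

Lemma measurable_radius_bound :
  measurable_fun setT (fun w => radius_bound sigma a C (Gw w)).
Proof.
apply: emeasurable_funD => //; apply: emeasurable_funD.
  by apply: emeasurable_sum => i; exact: measurable_row.
by apply: emeasurable_sum => j; exact: measurable_coordinate.
Qed.

(** The rows contribute n a^n D and the last term at most 2 C a^n. The coordinates give the
    quadratic order: there are n of them, each carrying wn <= n (1 + 2 / a). *)
Lemma integral_radius_bound :
  (\int[P]_w radius_bound sigma a C (Gw w) <=
   ((D + 2 * (1 + C) * (1 + 2 / a) * (D + 1) + 2 * C) *
    (n%:R ^+ 2 * a ^+ n))%:E)%E.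
Proof.
have mrows : measurable_fun setT
    (fun w => \sum_(i < n) \sum_(l <oo) (row_term i l w)%:E)%E.
  by apply: emeasurable_sum => i; exact: measurable_row.
have mcoords : measurable_fun setT
    (fun w => \sum_(j < n) coordinate_bound sigma a C (Gw w) j)%E.
  by apply: emeasurable_sum => j; exact: measurable_coordinate.
have rows_ge0 w : (0 <= \sum_(i < n) \sum_(l <oo) (row_term i l w)%:E)%E.
  by apply: sume_ge0 => i _; exact: row_sum_ge0.
have coords_ge0 w : (0 <= \sum_(j < n) coordinate_bound sigma a C (Gw w) j)%E.
  by apply: sume_ge0 => j _; exact: coordinate_ge0.
have n1 : 1 <= n%:R :> R by rewrite ler1n.
have sn : 0 <= 2 * sigma n by rewrite mulr_ge0// ltW.
rewrite /radius_bound ge0_integralD//=; last 2 first.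
- by move=> w _; exact: adde_ge0 (rows_ge0 w) (coords_ge0 w).
- exact: emeasurable_funD.
rewrite ge0_integralD//=; last by move=> w _; exact: rows_ge0.
rewrite (ge0_integral_sum _ _ _ (fun i w _ => row_sum_ge0 i w))//.
rewrite (ge0_integral_sum _ _ _ (fun j w _ => coordinate_ge0 j w))//.
rewrite integral_cst//= probability_setT mule1.
apply: (@le_trans _ _ (\sum_(i < n) (a ^+ n * D)%:E +
    \sum_(j < n) (2 * (1 + C) * (a ^+ n * wn * (D + 1)))%:E + (2 * sigma n)%:E)%E).
  apply: leeD => //; apply: leeD; apply: lee_sum => i _;
    first exact: integral_row.
  under eq_integral do rewrite coordinate_boundE.
  rewrite ge0_integralZl//=.
  - rewrite [leRHS]EFinM; apply: lee_wpmul2l; last exact: integral_tail.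
    by rewrite lee_fin; have := C_gt0; lra.
  - apply: emeasurable_funM; last exact: emeasurable_funD.
    by apply/measurable_EFinP; exact: measurable_funM.
  - move=> w _; apply: mule_ge0; first by rewrite lee_fin.
    apply: adde_ge0; last by rewrite lee_fin ltW.
    by apply: nneseries_ge0 => l _ _; rewrite lee_fin.
  - by rewrite lee_fin; have := C_gt0; lra.
rewrite !sumEFin -!EFinD lee_fin !sumr_const card_ord.
rewrite -[a ^+ n * D *+ n]mulr_natl -[2 * _ * _ *+ n]mulr_natl.
have sn_le : sigma n <= C * a ^+ n.
  apply: le_trans (sigma_le n) _;
    rewrite ler_pM2l// exprS ler_piMl ?(ltW an_gt0)//.
  exact: ltW.
have C0 := C_gt0; have an0 := an_gt0; have D0 := D_ge0.
have wn_le : wn <= n%:R * (1 + 2 / a) by rewrite /wn mulrDr mulr1 lerD2r.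
have n2 : n%:R <= n%:R ^+ 2 :> R by rewrite expr2 ler_peMl.
have n21 : 1 <= n%:R ^+ 2 :> R by apply: le_trans n2.
rewrite [leRHS]mulrDl [X in _ <= X + _]mulrDl; apply: lerD; first apply: lerD.
- have -> : D * (n%:R ^+ 2 * a ^+ n) = n%:R ^+ 2 * (a ^+ n * D) by ring.
  by apply: ler_wpM2r => //; exact: mulr_ge0 (ltW an0) D0.
- have -> : n%:R * (2 * (1 + C) * (a ^+ n * wn * (D + 1))) =
      wn * (n%:R * (2 * (1 + C) * (a ^+ n * (D + 1)))) by ring.
  have -> : 2 * (1 + C) * (1 + 2 / a) * (D + 1) * (n%:R ^+ 2 * a ^+ n) =
      n%:R * (1 + 2 / a) * (n%:R * (2 * (1 + C) * (a ^+ n * (D + 1)))) by ring.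
  apply: ler_wpM2r => //; apply: mulr_ge0 (ler0n _ _) _.
  by apply: mulr_ge0; [lra|apply: mulr_ge0 (ltW an0) _; lra].
- apply: (@le_trans _ _ (2 * (C * a ^+ n))); first by rewrite ler_pM2l.
  have -> : 2 * C * (n%:R ^+ 2 * a ^+ n) = n%:R ^+ 2 * (2 * (C * a ^+ n)) by ring.
  by rewrite ler_peMl// mulr_ge0// mulr_ge0// ltW.
Qed.

End bound.

End gaussian_matrix.

(* The radius is not known to be measurable; the integral of a nonnegative
   function is a supremum over the simple functions below it. *)
Section nonmeasurable_integrand.
Context d (T : measurableType d) (R : realType).
Context (mu : {measure set T -> \bar R}).
Import HBNNSimple.

Lemma ge0_le_integralT (f g : T -> \bar R) : (forall x, 0 <= f x)%E ->
  (forall x, f x <= g x)%E -> (\int[mu]_x f x <= \int[mu]_x g x)%E.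
Proof.
move=> f0 fg; rewrite !ge0_integralTE// => [|x]; last exact: le_trans (fg x).
by apply: ereal_sup_le => _ [h hf <-]; exists h => // x; exact: le_trans (fg x).
Qed.

(** A simple function below [f] is almost everywhere below [g], so monotonicity for measurable
    functions applies to it. *)
Lemma ge0_ae_le_integralT (f g : T -> \bar R) : (forall x, 0 <= f x)%E ->
  measurable_fun setT g -> (forall x, 0 <= g x)%E ->
  {ae mu, forall x, (f x <= g x)%E} -> (\int[mu]_x f x <= \int[mu]_x g x)%E.
Proof.
move=> f0 mg g0 fg; rewrite [leLHS]ge0_integralTE//.
apply: ge_ereal_sup => _ [h hf <-]; rewrite -integralT_nnsfun.
apply: ae_ge0_le_integral => //.
- by move=> x _; rewrite lee_fin.
- exact/measurable_EFinP.
- by apply: filterS fg => x fgx _; exact: le_trans (hf x) fgx.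
Qed.

End nonmeasurable_integrand.

Unset Implicit Arguments.

Theorem corollary9 (R : realType) (d : measure_display) (T : measurableType d)
    (P : probability T R)
    (G : forall n : nat, 'I_n -> nat -> {RV P >-> R})
    (hG : forall n : nat, gaussian_matrix (@G n))
    (sigma : nat -> R) (a : R)
    (sigma_ge0 : forall j : nat, 0 <= sigma j)
    (sigma_noninc : nonincreasing_seq sigma)
    (a_gt0 : 0 < a) (a_lt1 : a < 1)
    (sigma_asymp : asymp (fun n => (sigma n)%:E) (fun n => (a ^+ n.+1)%:E)) :
  preccurly (fun n => (a ^+ n.+1)%:E)
            (fun n => expected_radius sigma (@G n.+1)) /\
  preccurly (fun n => expected_radius sigma (@G n.+1))
            (fun n => (n.+1%:R ^+ 2 * a ^+ n.+1)%:E).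
Proof.
case: sigma_asymp => -[C C0 sC] [c c0 cs].
have sigma_le j : sigma j <= C * a ^+ j.+1 by have := sC j;
  rewrite -EFinM lee_fin.
have sigma_ge j : a ^+ j.+1 <= c * sigma j by have := cs j;
  rewrite -EFinM lee_fin.
(* The lower half of the asymptotics excludes zero semi-axes, so the convention on division by 0
   never comes into play. *)
have sigma_gt0 j : 0 < sigma j.
  have := lt_le_trans (exprn_gt0 j.+1 a_gt0) (sigma_ge j).
  by rewrite pmulr_rgt0.
have radius_ge m w : ((sigma m)%:E <= radius sigma (fun i j => @G m i j w))%E.
  exact: radius_ge_sigma.
have radius_ge0 m w : (0 <= radius sigma (fun i j => @G m i j w))%E.
  by apply: le_trans (radius_ge m w); rewrite lee_fin.
split.
  (* With n + 1 rows the lower bound is [sigma n.+1], which is compared with a^(n+2); dividing by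
     [a] makes up for the shift. *)
  exists (c / a); first exact: divr_gt0.
  move=> n; apply: (@le_trans _ _ ((c / a)%:E * (sigma n.+1)%:E)%E).
    rewrite -EFinM lee_fin mulrAC ler_pdivlMr// mulrC -exprS; exact: sigma_ge.
  apply: lee_wpmul2l; first by rewrite lee_fin ltW// divr_gt0.
  have -> : ((sigma n.+1)%:E = \int[P]_w (sigma n.+1)%:E)%E.
    by rewrite integral_cst//= probability_setT mule1.
  by apply: ge0_le_integralT => w; rewrite ?lee_fin.
pose D := 6 * C ^+ 2 / (1 - a).
exists (D + 2 * (1 + C) * (1 + 2 / a) * (D + 1) + 2 * C).
  have D0 : 0 <= D.
    by apply: divr_ge0; [exact: mulr_ge0 (sqr_ge0 C)|rewrite subr_ge0 ltW].
  apply: ltr_wpDl; last by rewrite mulr_gt0.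
  apply: addr_ge0 => //; apply: mulr_ge0; last lra.
  by apply: mulr_ge0; [lra|rewrite addr_ge0// divr_ge0// ltW].
move=> n; rewrite -EFinM.
apply: (le_trans _ (integral_radius_bound a_gt0 (hG n.+1) a_lt1 C0 (ltn0Sn n)
  sigma_gt0 sigma_le)).
apply: ge0_ae_le_integralT => //.
- exact: measurable_radius_bound.
- by move=> w; exact: radius_bound_ge0.
(* The exceptional event is the singularity of the leading square block: all rows, and the first n +
   1 columns. *)
apply: (negligibleS _ (negligible_det_gaussian_eq0 (hG n.+1) (@inj_id 'I_n.+1)
  (@ord_inj n.+1))) => w /= h.
by apply: contrapT => /eqP D0; apply: h; exact: radius_le_bound.
Qed.
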